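(* Let $\lambda>0$ and let $p=p_n$ satisfy $p\sim\lambda/n$ as $n\to\infty$. Let $W=W_n$ be the number of isolated vertices in an Erdős–Rényi random graph on $n$ vertices with edge probability $p$, and let $\sigma^2:=\mathrm{Var}(W)$. Then, as $n\to\infty$, $$d_{\mathrm{loc}}\bigl(\mathcal{L}(W),\mathrm{TP}(\mathbb{E}W,\mathrm{Var}(W))\bigr)=O\Bigl(\frac{\sqrt{\log(\sigma)}}{\sigma^2}\Bigr).$$
   Context: In the Erdős–Rényi random graph each of the $\binom n2$ possible edges is present independently with probability $p$; a vertex is isolated if it has degree $0$. Translated Poisson distribution: $Z\sim\mathrm{TP}(\mu,\sigma^2)$ means that $Z-s$ has the Poisson distribution with mean $\sigma^2+\gamma$, where $s:=\lfloor\mu-\sigma^2\rfloor$ and $\gamma:=\mu-\sigma^2-\lfloor\mu-\sigma^2\rfloor$. For integer valued $X,Y$: $d_{\mathrm{loc}}(\mathcal{L}(X),\mathcal{L}(Y)):=\sup_{a\in\mathbb{Z}}|\mathbb{P}[X=a]-\mathbb{P}[Y=a]|$. *)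

(* Defs.v *)
From HB Require Import structures.
From mathcomp Require Import all_boot all_order all_algebra.
From mathcomp Require Import all_classical all_reals all_analysis.

Set Implicit Arguments.
Unset Strict Implicit.
Unset Printing Implicit Defensive.
Import Order.TTheory GRing.Theory Num.Theory.
Import numFieldNormedType.Exports.
Local Open Scope classical_set_scope.
Local Open Scope ring_scope.

Definition edge (n : nat) := {e : {set 'I_n} | #|e| == 2%N}.

(* A simple graph on the vertex set 'I_n is an arbitrary set of edges. *)
Definition graph (n : nat) := {set edge n}.

HB.instance Definition _ (n : nat) := Finite.on (graph n).
HB.instance Definition _ (n : nat) := isPointed.Build (graph n) finset.set0.
HB.instance Definition _ (n : nat) := @isMeasurable.Build
  default_measure_display (graph n) discrete_measurable discrete_measurable0
  discrete_measurableC discrete_measurableU.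

Definition degree (n : nat) (G : graph n) (v : 'I_n) : nat :=
  #|[pred e in G | v \in \val e]|.

Definition num_isolated (n : nat) (G : graph n) : nat :=
  #|[pred v : 'I_n | degree G v == 0%N]|.

Section erdos_renyi.
Context {R : realType}.
Variables (n : nat) (p : {i01 R}).

(* Edges are independent and each present with probability p, so the
   probability of a graph is a product over all the possible edges. *)
Definition er_pmf (G : graph n) : R :=
  \prod_(e : edge n) (if e \in G then p%:num else 1 - p%:num).

Definition er_prob (A : set (graph n)) : \bar R :=
  (\esum_(G in A) (er_pmf G)%:E)%E.

Lemma er_pmf_ge0 G : 0 <= er_pmf G.
Proof.
apply: prodr_ge0 => e _; case: ifP => _; first by [].
by rewrite subr_ge0.
Qed.

Let er_prob0 : er_prob set0 = 0%E.
Proof. by rewrite /er_prob esum_set0. Qed.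

Let er_prob_ge0 A : (0 <= er_prob A)%E.
Proof. by apply: esum_ge0 => G _; rewrite lee_fin er_pmf_ge0. Qed.

Let er_prob_sigma_additive : semi_sigma_additive er_prob.
Proof.
move=> F mF tF mUF; rewrite /er_prob; apply: cvg_toP.
  apply: ereal_nondecreasing_is_cvgn => a b ab.
  apply: lee_sum_nneg_natr => // k _ _; exact: er_prob_ge0.
by rewrite nneseries_sum_bigcup// => i; rewrite lee_fin er_pmf_ge0.
Qed.

HB.instance Definition _ := isMeasure.Build _ _ _ er_prob
  er_prob0 er_prob_ge0 er_prob_sigma_additive.

Let er_prob_setT : er_prob [set: graph n] = 1%E.
Proof.
have fin : finite_set [set: graph n] by exact: finite_finset.
rewrite /er_prob esum_fset//=; last first.
  by move=> G _; rewrite lee_fin er_pmf_ge0.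
rewrite fsbig_finite//= (perm_big (index_enum (graph n)))/=; last first.
  apply: uniq_perm => [||G]; [exact: finmap.fset_uniq|exact: index_enum_uniq|].
  apply/idP/idP => _; first exact: mem_index_enum.
  by rewrite in_fset_set//; exact: mem_set.
have sum1 : \sum_(G : graph n) er_pmf G = 1.
  rewrite -(bigA_distr _ _ (fun=> p%:num) (fun=> 1 - p%:num)) big1// => e _.
  exact: subrKC.
by rewrite -sum1 -sumEFin.
Qed.

HB.instance Definition _ :=
  @Measure_isProbability.Build _ _ R er_prob er_prob_setT.

End erdos_renyi.
Arguments er_prob {R} n p A.

HB.instance Definition _ := isPointed.Build int 0.
HB.instance Definition _ := @isMeasurable.Build
  default_measure_display int discrete_measurable discrete_measurable0
  discrete_measurableC discrete_measurableU.

Section laws_on_int.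
Context {R : realType}.

Definition translated_poisson (mu v : R) : set int -> \bar R :=
  let s := Num.floor (mu - v) in
  let gamma := mu - v - s%:~R in
  (* [poisson_prob] ignores its second argument *)
  pushforward (poisson_prob (v + gamma) 0%N) (fun k : nat => k%:Z + s).

Definition dloc (P Q : set int -> \bar R) : R :=
  sup [set `|fine (P [set a]) - fine (Q [set a])| | a in [set: int]].

End laws_on_int.

Section isolated_vertices.
Context {R : realType}.
Variables (n : nat) (p : {i01 R}).

Definition isolated_law : set int -> \bar R :=
  pushforward (er_prob n p) (fun G => (num_isolated G)%:Z).

Definition isolated_mean : R :=
  fine 'E_(er_prob n p)[fun G => (num_isolated G)%:R].

Definition isolated_var : R :=
  fine 'V_(er_prob n p)[fun G => (num_isolated G)%:R].

End isolated_vertices.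

(* Main.v *)
(** Write W_n for the number of isolated vertices, q = 1 - p, mu_n = n q^(n-1)
    for its mean and D for the forward difference. Newton's formula and the
    explicit binomial moments of W_n give two exact identities:
      - size bias: E[W_(n+1) h(W_(n+1))] = mu_(n+1) E[h(W_n + 1)];
      - adding a vertex: E[h(W_(n+1))] = E[T h(W_n)] + q^n E[D h(W_n)], where T
        averages h over a binomial thinning of its argument with parameter q.
    By the first one, the gap d_n(h) = E[h(W_(n+1))] - E[h(W_n + 1)] equals
    E[(1 - W_(n+1) / mu_(n+1)) h(W_(n+1))], and the second-order gap
    d_(n+1)(h) - d_n(h(. + 1)) is O(1/n) uniformly for |h| <= 1. By the second
    one, d_n(h) is -(1 - q^n) E[D h(W_n)] up to a term which, after
    differentiating in the thinning parameter, is at most p mu_n / q times a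
    quantity of the same kind. Since 1 - q^n - p mu_n is the probability that a
    binomial variable is at least 2, this is a contraction, whence
    d_n(D h) = O(1/n) and then E[D (D h)(W_n)] = O(1/n).
    For the solution g of the Stein equation of the Poisson distribution of
    parameter m, which satisfies |g| <= 1/m, these estimates, together with the
    exact formula Var W_(n+1) = mu_(n+1) (1 - q^n + p mu_n), give a bound
    O(1/sigma^2) without the logarithmic factor. *)

Require Import Defs.
From mathcomp Require Import all_boot all_order all_algebra.
From mathcomp Require Import all_classical all_reals all_analysis.
From mathcomp Require Import ring lra zify.
Import Order.TTheory GRing.Theory Num.Theory.
Import numFieldNormedType.Exports.
Local Open Scope classical_set_scope.
Local Open Scope ring_scope.
Set Implicit Arguments.
Unset Strict Implicit.

(** * Forward differences and binomial thinning *)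

Section operators.
Context {R : realType}.
Implicit Types (h : nat -> R) (t : R).

Definition succf h : nat -> R := fun w => h w.+1.
Definition fdiff h : nat -> R := fun w => h w.+1 - h w.

(* [thin t h w] is the expectation of [h] at a binomial variable with
   parameters [w] and [1 - t]. *)
Fixpoint thin t h (w : nat) {struct w} : R :=
  if w is w'.+1 then t * thin t h w' + (1 - t) * thin t (succf h) w' else h 0%N.

Lemma thinD t h1 h2 w :
  thin t (fun w => h1 w + h2 w) w = thin t h1 w + thin t h2 w.
Proof.
elim: w h1 h2 => [//|w IH] h1 h2 /=.
by rewrite IH -[succf _]/(fun v => succf h1 v + succf h2 v) IH; ring.
Qed.

Lemma thinZ t c h w : thin t (fun w => c * h w) w = c * thin t h w.
Proof.
elim: w h => [//|w IH] h /=.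
by rewrite IH -[succf _]/(fun v => c * succf h v) IH; ring.
Qed.

Lemma thin_fdiff t h w : thin t (fdiff h) w = thin t (succf h) w - thin t h w.
Proof.
have := thinD t (succf h) (fun v => -1 * h v) w; rewrite thinZ mulN1r => <-.
by congr (thin t _ w); apply/funext => v; rewrite /fdiff /succf mulN1r.
Qed.

Lemma fdiff_thin t h w : fdiff (thin t h) w = (1 - t) * thin t (fdiff h) w.
Proof. by rewrite thin_fdiff /fdiff /=; ring. Qed.

Lemma thin0 h w : thin 0 h w = h w.
Proof. by elim: w h => [//|w IH] h /=; rewrite !IH /succf; ring. Qed.

Lemma norm_thin t h c w : 0 <= t <= 1 -> (forall v, `|h v| <= c) ->
  `|thin t h w| <= c.
Proof.
move=> /andP[t0 t1]; elim: w h => [|w IH] h hc /=; first exact: hc.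
apply: (le_trans (ler_normD _ _)).
have -> : c = t * c + (1 - t) * c by ring.
rewrite !normrM (ger0_norm t0) (@ger0_norm _ (1 - t)) ?subr_ge0//.
by apply: lerD; rewrite ler_wpM2l ?subr_ge0 ?IH// => v; exact: hc.
Qed.

Lemma norm_fdiff h c : (forall v, `|h v| <= c) -> forall v, `|fdiff h v| <= 2 * c.
Proof.
move=> hc v; apply: (le_trans (ler_normB _ _)).
by have := lerD (hc v.+1) (hc v); lra.
Qed.

(** Each of the [w] trials contributes equally: given the others, changing the failure probability
    of one trial costs minus a difference of [h]. At [w = 0] the factor [w%:R] cancels the default
    value of [w.-1]. *)
Lemma is_derive_thin t h w :
  is_derive t 1 (fun u => thin u h w) (- (w%:R * thin t (fdiff h) w.-1)).
Proof.
elim: w h => [|w IH] h /=.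
  by rewrite mul0r oppr0; exact: is_derive_cst.
have I1 : is_derive t 1 (fun u : R => 1 - u) (-1).
  by apply: is_derive_eq; rewrite add0r mul1r.
have Hd := is_deriveD (is_deriveM (is_derive_id t (1 : R)) (IH h))
  (is_deriveM I1 (IH (succf h))).
apply: (is_derive_eq Hd).
rewrite /GRing.scale/= !thin_fdiff.
case: w {IH Hd} => [|w] /=; first by ring.
rewrite -[w.+2]addn1 natrD; ring.
Qed.

(** The binomials vanish beyond [w], so the cut-off [N] is free and one range of summation serves
    all graphs at once. *)
Lemma newton N h w : (w <= N)%N ->
  h w = \sum_(k < N.+1) 'C(w, k)%:R * iter k fdiff h 0%N.
Proof.
elim: w h => [|w IH] h wN.
  by rewrite big_ord_recl bin0 mul1r big1 ?addr0// => k _; rewrite bin0n/= mul0r.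
have -> : h w.+1 = h w + fdiff h w by rewrite /fdiff; ring.
rewrite (IH h (ltnW wN)) (IH (fdiff h) (ltnW wN)).
rewrite big_ord_recl [X in _ + X = _]big_ord_recr [RHS]big_ord_recl /=.
rewrite (bin_small wN) mul0r addr0 -addrA -big_split/= !bin0; congr (_ + _).
apply: eq_bigr => k _; rewrite /bump /= add1n binS natrD -iterSr iterS; ring.
Qed.

Lemma iter_fdiff_ext h1 h2 k w : (forall v, h1 v = h2 v) ->
  iter k fdiff h1 w = iter k fdiff h2 w.
Proof. by move=> /funext->. Qed.

Lemma iter_fdiff_lin a b h1 h2 k w :
  iter k fdiff (fun v => a * h1 v + b * h2 v) w =
  a * iter k fdiff h1 w + b * iter k fdiff h2 w.
Proof.
elim: k w => [//|k IH] w /=; rewrite /fdiff !IH; ring.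
Qed.

(** A Leibniz rule. At [w = 0] only the second term survives, so multiplication by the variable
    shifts the Newton coefficients. *)
Lemma iter_fdiff_mulid h k w : iter k fdiff (fun v => v%:R * h v) w =
  w%:R * iter k fdiff h w + k%:R * iter k.-1 fdiff (succf h) w.
Proof.
elim: k w => [|k IH] w /=; first by ring.
rewrite {1}/fdiff !IH; case: k IH => [|k] IH /=.
  by rewrite /fdiff /succf -addn1 natrD; ring.
have -> v : iter k fdiff (succf h) v.+1 =
    iter k fdiff (succf h) v + fdiff (iter k fdiff (succf h)) v.
  by rewrite /fdiff; ring.
have E v : iter k fdiff (succf h) v = iter k fdiff h v.+1.
  by elim: k v {IH} => [//|k IHk] v /=; rewrite /fdiff !IHk.
rewrite /fdiff !E -[w.+1]addn1 -[k.+2]addn1 !natrD; ring.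
Qed.

(** At 0, where thinning is the identity, the k-th Newton coefficient is thus just rescaled by (1 -
    t)^k. *)
Lemma iter_fdiff_thin t h k w :
  iter k fdiff (thin t h) w = (1 - t) ^+ k * thin t (iter k fdiff h) w.
Proof.
elim: k w => [|k IH] w /=; first by rewrite expr0 mul1r.
by rewrite {1}/fdiff !IH -mulrBr -/(fdiff _ w) fdiff_thin exprSr mulrA.
Qed.

End operators.

(** * Binomial moments of the number of isolated vertices and the two exact identities *)

Section factorial_moments.
Context {R : realType}.
Variable p : {i01 R}.
Notation q := (1 - p%:num : R).

Definition expect n (h : nat -> R) : R :=
  \sum_(G : graph n) er_pmf p G * h (num_isolated G).

Definition avoids n (A : {set 'I_n}) (e : edge n) : bool := [disjoint val e & A]%B.

Definition isolated n (G : graph n) : {set 'I_n} :=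
  [set v | degree G v == 0%N]%SET.

Lemma subset_isolatedE n (G : graph n) (A : {set 'I_n}) :
  (A \subset isolated G) =
  [forall e : edge n, (e \in G) ==> avoids A e].
Proof.
apply/fintype.subsetP/forallP => [AI e|H v vA].
  apply/implyP => eG; rewrite /avoids disjoint_subset.
  apply/fintype.subsetP => v ve; apply/negP => vA.
  have := AI v vA; rewrite inE /degree => /eqP/card0_eq/(_ e).
  by rewrite !inE eG ve.
rewrite inE /degree; apply/eqP; apply: eq_card0 => e; rewrite !inE.
apply/negbTE/negP => /andP[eG ve].
have /implyP/(_ eG) := H e; rewrite /avoids disjoint_subset => /fintype.subsetP/(_ v ve).
by rewrite inE /= vA.
Qed.

Lemma card_edges_disjoint n (A : {set 'I_n}) :
  #|[pred e : edge n | avoids A e]| = 'C(n - #|A|, 2).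
Proof.
have <- : #|~: A| = (n - #|A|)%N by rewrite cardsCs finset.setCK card_ord.
rewrite -cards_draws -(fintype.card_image (@val_inj _ _ (edge n))).
apply: eq_card => B; rewrite !inE; apply/fintype.imageP/andP => [[e]|[BA B2]].
  by rewrite inE /avoids => eA ->; split; [rewrite -finset.disjoints_subset | exact: (valP e)].
by exists (exist _ B B2) => //; rewrite inE /avoids /= finset.disjoints_subset.
Qed.

(** With the indicator moved inside the product over edges, the sum over graphs factors: an edge
    avoiding [A] contributes p + q = 1, and an edge meeting [A], which must be absent, contributes
    q. *)
Lemma prob_subset_isolated n (A : {set 'I_n}) :
  \sum_(G : graph n) er_pmf p G * (A \subset isolated G)%:R =
  q ^+ ('C(n, 2) - 'C(n - #|A|, 2)).
Proof.
under eq_bigr => G _.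
  have -> : er_pmf p G * (A \subset isolated G)%:R =
    \prod_(e : edge n)
      (if e \in G then p%:num * (avoids A e)%:R else q).
    rewrite subset_isolatedE /er_pmf.
    case: (boolP [forall _, _]) => [/forallP H|].
      rewrite mulr1; apply: eq_bigr => e _; case: ifP => // eG.
      by have /implyP/(_ eG)-> := H e; rewrite mulr1.
    rewrite negb_forall => /existsP[e]; rewrite negb_imply => /andP[eG /negbTE eA].
    by rewrite mulr0 (bigD1 e)//= eG eA mulr0 mul0r.
  over.
rewrite -(bigA_distr _ _ (fun e : edge n => p%:num * (avoids A e)%:R)
  (fun=> q)) /=.
rewrite (bigID [pred e : edge n | avoids A e]) /= big1 ?mul1r; last first.
  by move=> e ->; rewrite mulr1; ring.
under eq_bigr => e /negbTE-> do rewrite mulr0 add0r.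
rewrite prodr_const; congr (_ ^+ _).
have := cardC [pred e : edge n | avoids A e].
rewrite card_edges_disjoint -[X in _ = X](_ : 'C(n, 2) = _); last first.
  by have := card_edges_disjoint (@finset.set0 'I_n); rewrite cards0 subn0 => <-;
    apply: eq_card => e; rewrite !inE /avoids finset.disjoints_subset finset.setC0 finset.subsetT.
by move=> <-; rewrite addKn; apply: eq_card => e; rewrite !inE.
Qed.

(* A set of [k] vertices is avoided by ['C(n - k, 2)] of the ['C(n, 2)] edges. *)
Definition binmom n k : R := 'C(n, k)%:R * q ^+ ('C(n, 2) - 'C(n - k, 2)).

Lemma expect_bin n k : expect n (fun w => 'C(w, k)%:R) = binmom n k.
Proof.
rewrite /expect; under eq_bigr => G _.
  have -> : 'C(num_isolated G, k)%:R =
    \sum_(A : {set 'I_n} | #|A| == k) (A \subset isolated G)%:R :> R.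
    have -> : num_isolated G = #|isolated G| by rewrite cardsE.
    rewrite -cards_draws -sum1_card natr_sum big_mkcond /=.
    rewrite [RHS]big_mkcond; apply: eq_bigr => A _; rewrite !inE.
    by case: (A \subset _); case: (#|A| == k).
  rewrite big_distrr; over.
rewrite exchange_big /=.
under eq_bigr => A /eqP Ak do rewrite prob_subset_isolated Ak.
rewrite sumr_const /binmom mulr_natl; congr (_ *+ _).
by rewrite -[in RHS](card_ord n) -card_draws cardsE.
Qed.

Lemma num_isolated_le n (G : graph n) : (num_isolated G <= n)%N.
Proof. by rewrite /num_isolated -[X in (_ <= X)%N](card_ord n) max_card. Qed.

(** Reduces the size-bias and add-vertex identities to recursions for [binmom]. *)
Lemma expectE N n h : (n <= N)%N ->
  expect n h = \sum_(k < N.+1) binmom n k * iter k fdiff h 0%N.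
Proof.
move=> nN; rewrite /expect; under eq_bigr => G _.
  rewrite (newton _ (leq_trans (num_isolated_le G) nN)) big_distrr; over.
rewrite exchange_big /=; apply: eq_bigr => k _.
rewrite -expect_bin /expect big_distrl; apply: eq_bigr => G _ /=; ring.
Qed.

Lemma binmom_small n k : (n < k)%N -> binmom n k = 0.
Proof. by move=> nk; rewrite /binmom bin_small// mul0r. Qed.

(** Either the set of k + 1 vertices contains the new vertex, whose n edges must be absent, or it
    does not, and then its k + 1 edges to the new vertex must be absent. *)
Lemma binmomS n k : binmom n.+1 k.+1 = q ^+ n * binmom n k + q ^+ k.+1 * binmom n k.+1.
Proof.
case: (ltngtP n k) => [nk|kn|<-].
- by rewrite !binmom_small ?ltnS// ?mulr0 ?addr0// ltnW.
- rewrite /binmom binS natrD mulrDl addrC; congr (_ + _); rewrite mulrCA -exprD.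
    congr (_ * q ^+ _); rewrite subSS binS bin1.
    have := @leq_bin2l (n - k) n 2 (leq_subr _ _); lia.
  rewrite subSS; congr (_ * q ^+ _).
  have -> : (n - k)%N = (n - k.+1).+1 by lia.
  rewrite !binS !bin1.
  have := @leq_bin2l (n - k.+1) n 2 (leq_subr _ _); lia.
- rewrite [X in _ + _ * X]binmom_small// mulr0 addr0 /binmom !binn !mul1r !subnn !subn0.
  by rewrite -exprD binS bin1 addnC.
Qed.

Definition iso_mean n : R := n%:R * q ^+ n.-1.

(** Mark one vertex of the set: there are n + 1 choices, its n edges are absent with probability
    q^n, and k vertices remain to be chosen in a graph on n vertices. *)
Lemma binmom_size_bias n k : k.+1%:R * binmom n.+1 k.+1 = iso_mean n.+1 * binmom n k.
Proof.
rewrite /binmom /iso_mean /= subSS mulrA -natrM -mul_bin_diag /= natrM.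
case: (leqP k n) => kn; last by rewrite bin_small// mulr0 !mul0r mulr0.
rewrite -!mulrA; congr (_ * _); rewrite mulrCA -exprD; congr (_ * q ^+ _).
rewrite binS bin1.
have := @leq_bin2l (n - k) n 2 (leq_subr _ _); lia.
Qed.

Lemma expect_size_bias n h : expect n.+1 (fun w => w%:R * h w) = iso_mean n.+1 * expect n (succf h).
Proof.
rewrite (expectE (N := n.+1))// (expectE (N := n))// big_ord_recl /=.
rewrite mul0r mulr0 add0r big_distrr; apply: eq_bigr => k _ /=.
rewrite mulrA -binmom_size_bias -/(iter k.+1 fdiff _) iter_fdiff_mulid /= /bump /=.
rewrite mul0r add0r add1n; ring.
Qed.

(** An isolated vertex survives the arrival of a new vertex with probability q, hence the thinning.
    With probability q^n all new edges are absent; then nothing is lost and the new vertex counts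
    too, hence the difference term. *)
Lemma expect_add_vertex n h :
  expect n.+1 h = expect n (fun w => thin p%:num h w + q ^+ n * fdiff h w).
Proof.
rewrite !(expectE (N := n.+1))//.
have E k : iter k fdiff (fun w => thin p%:num h w + q ^+ n * fdiff h w) 0%N =
    q ^+ k * iter k fdiff h 0%N + q ^+ n * iter k.+1 fdiff h 0%N.
  have := iter_fdiff_lin 1 (q ^+ n) (thin p%:num h) (fdiff h) k 0.
  rewrite iter_fdiff_thin /= mul1r -iterSr /= => <-.
  by apply: iter_fdiff_ext => v; rewrite mul1r.
under [RHS]eq_bigr => k _ do rewrite E mulrDr.
rewrite big_split /= [X in _ + X]big_ord_recr /= binmom_small// mul0r addr0.
rewrite big_ord_recl [X in _ = X + _]big_ord_recl /= -addrA -big_split /=.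
congr (_ + _); first by rewrite /binmom !bin0 !subn0 !subnn !expr0; ring.
apply: eq_bigr => k _; rewrite /bump /= add1n binmomS; ring.
Qed.

End factorial_moments.

(** For U the supremum of |f| on [P], which [U0] makes finite, the contraction gives a U <= A + b
    U. *)
Lemma le_contraction {R : realType} (T : Type) (P : T -> Prop) (f : T -> R)
    (a b A g U0 : R) :
  0 < g -> 0 <= b -> g <= a - b -> 0 <= A ->
  (forall x, P x -> `|f x| <= U0) ->
  (forall U, 0 <= U -> (forall x, P x -> `|f x| <= U) ->
    forall x, P x -> a * `|f x| <= A + b * U) ->
  forall x, P x -> `|f x| <= A / g.
Proof.
move=> g0 b0 gab A0 fU0 contr x Px.
pose E := [set `|f y| | y in P].
have Ex : E `|f x| by exists x.
have ubE : has_ubound E by exists U0 => _ [y Py <-]; exact: fU0.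
pose U := sup E.
have fU y : P y -> `|f y| <= U by move=> Py; apply: ub_le_sup => //; exists y.
have U_ge0 : 0 <= U := le_trans (normr_ge0 _) (fU x Px).
have a0 : 0 < a by lra.
have : U <= (A + b * U) / a.
  apply: ge_sup => [|_ [y Py <-]]; first by exists `|f x|.
  by rewrite ler_pdivlMr// mulrC; exact: contr.
rewrite ler_pdivlMr// => aU.
apply: (le_trans (fU x Px)); rewrite ler_pdivlMr//.
have := ler_wpM2l U_ge0 gab; lra.
Qed.

(** * Moments, size-bias gaps and derivatives in the thinning parameter *)

Section expectation.
Context {R : realType}.
Variable p : {i01 R}.
Notation q := (1 - p%:num : R).
Notation ew := (expect p).
Notation mu := (iso_mean p).

Lemma expect_lin n a b h1 h2 :
  ew n (fun w => a * h1 w + b * h2 w) = a * ew n h1 + b * ew n h2.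
Proof.
rewrite /expect !mulr_sumr -big_split; apply: eq_bigr => G _ /=; ring.
Qed.

Lemma expectD n h1 h2 : ew n (fun w => h1 w + h2 w) = ew n h1 + ew n h2.
Proof.
rewrite -[ew n h1]mul1r -[ew n h2]mul1r -expect_lin; congr (ew n _).
by apply/funext => w; rewrite !mul1r.
Qed.

Lemma expectZ n a h : ew n (fun w => a * h w) = a * ew n h.
Proof. by rewrite /expect mulr_sumr; apply: eq_bigr => G _; ring. Qed.

Lemma expectB n h1 h2 : ew n (fun w => h1 w - h2 w) = ew n h1 - ew n h2.
Proof.
rewrite expectD -[- ew n h2]mulN1r -expectZ; congr (_ + ew n _).
by apply/funext => w; rewrite mulN1r.
Qed.

Lemma expectN n h : ew n (fun w => - h w) = - ew n h.
Proof. by rewrite -mulN1r -expectZ; congr (ew n _); apply/funext => w; rewrite mulN1r. Qed.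

Lemma expect1 n : ew n (fun=> 1) = 1.
Proof.
rewrite [RHS](_ : 1 = binmom p n 0); last by rewrite /binmom bin0 subn0 subnn expr0 mulr1.
by rewrite -expect_bin; congr (ew n _); apply/funext => w; rewrite bin0.
Qed.

Lemma expect_cst n a : ew n (fun=> a) = a.
Proof. by have := expectZ n a (fun=> 1); rewrite expect1 !mulr1. Qed.

Lemma expect_le n h1 h2 : (forall w, h1 w <= h2 w) -> ew n h1 <= ew n h2.
Proof. by move=> h12; apply: ler_sum => G _; apply: ler_wpM2l => //; exact: er_pmf_ge0. Qed.

Lemma norm_expect_le n h : `|ew n h| <= ew n (fun w => `|h w|).
Proof.
apply: (le_trans (ler_norm_sum _ _ _)); apply: ler_sum => G _.
by rewrite normrM ger0_norm ?er_pmf_ge0.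
Qed.

Lemma norm_expect n h c : (forall w, `|h w| <= c) -> `|ew n h| <= c.
Proof.
move=> hc; rewrite (le_trans (norm_expect_le _ _))//.
by rewrite -[leRHS](expect_cst n) expect_le.
Qed.

Lemma norm_expectM n h k c : (forall w, `|h w| <= c) ->
  `|ew n (fun w => k w * h w)| <= c * ew n (fun w => `|k w|).
Proof.
move=> hc; apply: (le_trans (norm_expect_le _ _)); rewrite -expectZ; apply: expect_le => w.
by rewrite normrM mulrC ler_wpM2r.
Qed.

Lemma mu_ge0 n : 0 <= mu n.
Proof. by rewrite /iso_mean mulr_ge0// exprn_ge0// subr_ge0. Qed.

Lemma muS_sub n : mu n.+2 - mu n.+1 = q ^+ n * (1 - n.+2%:R * p%:num).
Proof. rewrite /iso_mean /= exprS -[n.+2]addn2 -[n.+1]addn1 !natrD; ring. Qed.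

Lemma expect_id n : ew n (fun w => w%:R) = mu n.
Proof.
have -> : (fun w => w%:R) = (fun w => w%:R * 1 : R) by apply/funext => w; rewrite mulr1.
case: n => [|n]; last by rewrite expect_size_bias [succf _](_ : _ = fun=> 1)// expect1 mulr1.
rewrite /iso_mean mul0r; apply: big1 => G _.
by have := num_isolated_le G; rewrite leqn0 => /eqP->; rewrite mul0r mulr0.
Qed.

Lemma expect_sqr n : ew n.+1 (fun w => w%:R ^+ 2) = mu n.+1 * (mu n + 1).
Proof.
have -> : (fun w => w%:R ^+ 2) = (fun w => w%:R * w%:R : R) by apply/funext => w; rewrite expr2.
rewrite expect_size_bias; congr (_ * _).
rewrite -expect_id -[X in _ = _ + X](expect1 n) -expectD; congr (ew n _).
by apply/funext => w; rewrite /succf -addn1 natrD.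
Qed.

(** Size biasing gives the second moment; the recursion mu_(n+1) = q mu_n + q^n gives the last
    factor, which is the coefficient in [bias_gap_expansion]. *)
Lemma expect_var n : ew n.+1 (fun w => (w%:R - mu n.+1) ^+ 2) =
  mu n.+1 * (1 - q ^+ n + p%:num * mu n).
Proof.
have -> : (fun w => (w%:R - mu n.+1) ^+ 2) =
    (fun w => 1 * w%:R ^+ 2 + 1 * (- 2 * mu n.+1 * w%:R + mu n.+1 ^+ 2 * 1)).
  by apply/funext => w; ring.
rewrite !expect_lin expect_sqr expect_id expect1.
suff E : mu n.+1 = mu n * q + q ^+ n by rewrite !E; ring.
rewrite /iso_mean /=; case: n => [|n] /=; first by ring.
rewrite exprSr -[n.+2]addn1 natrD; ring.
Qed.

(* By [expect_size_bias], [W_n + 1] has the size-biased law of [W_(n+1)]. *)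
Definition bias_gap n h : R := ew n.+1 h - ew n (succf h).

Lemma bias_gapD n h1 h2 : bias_gap n (fun w => h1 w + h2 w) = bias_gap n h1 + bias_gap n h2.
Proof.
rewrite /bias_gap [succf _](_ : _ = fun w => succf h1 w + succf h2 w)// !expectD.
ring.
Qed.

Lemma bias_gapZ n a h : bias_gap n (fun w => a * h w) = a * bias_gap n h.
Proof. by rewrite /bias_gap [succf _](_ : _ = fun w => a * succf h w)// !expectZ; ring. Qed.

Lemma norm_bias_gap n h c : (forall w, `|h w| <= c) -> `|bias_gap n h| <= 2 * c.
Proof.
move=> hc; apply: (le_trans (ler_normB _ _)).
have := lerD (norm_expect n.+1 hc) (norm_expect n (fun w => hc w.+1)); rewrite /succf; lra.
Qed.

Lemma bias_gap_size_bias n h : mu n.+1 * bias_gap n h = ew n.+1 (fun w => (mu n.+1 - w%:R) * h w).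
Proof.
rewrite /bias_gap mulrBr -expect_size_bias -expectZ -expectB; congr (ew _ _).
by apply/funext => w; rewrite mulrBl.
Qed.

(** Size biasing once and twice brings all the expectations to n + 2 vertices. *)
Lemma bias_gap_second_difference n h : 0 < mu n.+1 -> 0 < mu n.+2 ->
  bias_gap n.+1 h - bias_gap n (succf h) = ew n.+2 (fun w =>
    (1 - 2 * w%:R / mu n.+2 + w%:R * (w%:R - 1) / (mu n.+2 * mu n.+1)) * h w).
Proof.
move=> m1 m2; rewrite /bias_gap.
have -> : ew n.+1 (succf h) = ew n.+2 (fun w => w%:R * h w) / mu n.+2.
  by rewrite expect_size_bias mulrAC divff ?mul1r ?gt_eqF.
have -> : ew n (succf (succf h)) =
    ew n.+2 (fun w => w%:R * ((w%:R - 1) * h w)) / mu n.+2 / mu n.+1.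
  rewrite expect_size_bias [mu n.+2 * _ / mu n.+2]mulrAC divff ?mul1r ?gt_eqF//.
  have -> : succf (fun w => (w%:R - 1) * h w) = (fun w => w%:R * succf h w).
    by apply/funext => w; rewrite /succf -addn1 natrD addrK.
  by rewrite expect_size_bias mulrAC divff ?mul1r ?gt_eqF.
set c1 := mu n.+2 in m2 *; set c2 := mu n.+1 in m1 *.
rewrite -[ew n.+2 h]mul1r.
transitivity (1 * ew n.+2 h + 1 * ((- 2 / c1) * ew n.+2 (fun w => w%:R * h w) +
  (c1^-1 / c2) * ew n.+2 (fun w => w%:R * ((w%:R - 1) * h w)))).
  by field; rewrite !gt_eqF.
rewrite -!expect_lin; congr (ew _ _); apply/funext => w.
by field; rewrite !gt_eqF.
Qed.

(** Up to small corrections the weight found above is the square of 1 - w / mu_(n+2), whose mean is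
    variance over squared mean. *)
Lemma bias_gap_second_difference_le n h c M B :
  1 <= M -> M <= mu n.+1 -> M <= mu n.+2 -> `|mu n.+2 - mu n.+1| <= B ->
  (forall w, `|h w| <= c) ->
  `|bias_gap n.+1 h - bias_gap n (succf h)| <= c * ((3 * B + 2) / M).
Proof.
move=> M1 m1 m2 HB hc.
have c0 : 0 <= c := le_trans (normr_ge0 _) (hc 0%N).
have M0 : 0 < M by lra.
have m10 : 0 < mu n.+1 by lra.
have m20 : 0 < mu n.+2 by lra.
rewrite bias_gap_second_difference//; apply: (le_trans (norm_expectM _ _ hc)).
apply: ler_wpM2l => //.
set c1 := mu n.+2 in m2 m20 HB *; set c2 := mu n.+1 in m1 m10 HB *.
have B0 : 0 <= B := le_trans (normr_ge0 _) HB.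
have c1i : 0 < c1^-1 by rewrite invr_gt0.
have c2i : 0 < c2^-1 by rewrite invr_gt0.
(* Bounds the error of replacing 1 / (c1 c2) by 1 / c1^2, which completes the square. *)
pose D := B / (c1 ^+ 2 * c2).
have HD : `|(c1 * c2)^-1 - (c1 ^+ 2)^-1| <= D.
  have -> : (c1 * c2)^-1 - (c1 ^+ 2)^-1 = (c1 - c2) / (c1 ^+ 2 * c2).
    by field; rewrite !gt_eqF.
  have P0 : 0 < c1 ^+ 2 * c2 by rewrite mulr_gt0// exprn_gt0.
  by rewrite normrM normfV (gtr0_norm P0) /D ler_wpM2r// invr_ge0 ltW.
apply: (@le_trans _ _ (ew n.+2 (fun w =>
    ((c1 ^+ 2)^-1 + D) * w%:R ^+ 2 + 1 * ((- 2 / c1 + (c1 * c2)^-1) * w%:R + 1 * 1)))).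
  apply: expect_le => w.
  have -> : 1 - 2 * w%:R / c1 + w%:R * (w%:R - 1) / (c1 * c2) =
    (1 - w%:R / c1) ^+ 2 + ((c1 * c2)^-1 - (c1 ^+ 2)^-1) * w%:R ^+ 2 - w%:R / (c1 * c2).
    by field; rewrite !gt_eqF.
  apply: (@le_trans _ _ ((1 - w%:R / c1) ^+ 2 + D * w%:R ^+ 2 + w%:R / (c1 * c2))).
    apply: (le_trans (ler_normB _ _)); apply: lerD; last first.
      by rewrite ger0_norm// divr_ge0// mulr_ge0// ltW.
    apply: (le_trans (ler_normD _ _)); apply: lerD; first by rewrite ger0_norm// sqr_ge0.
    by rewrite normrM (ger0_norm (sqr_ge0 _)) ler_wpM2r// sqr_ge0.
  by rewrite le_eqVlt; apply/orP; left; apply/eqP; field; rewrite !gt_eqF.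
rewrite !expect_lin expect_sqr expect_id expect1 -/c1 -/c2.
have -> : ((c1 ^+ 2)^-1 + D) * (c1 * (c2 + 1)) + 1 * ((-2 / c1 + (c1 * c2)^-1) * c1 + 1 * 1)
  = (1 - (c1 - c2)) / c1 + B * (1 + c2^-1) / c1 + c2^-1.
  by rewrite /D; field; rewrite !gt_eqF.
have iM x : M <= x -> x^-1 <= M^-1 by move=> Mx; rewrite lef_pV2 ?posrE//; lra.
have I1 := iM _ m1; have I2 := iM _ m2.
have E1 : (1 - (c1 - c2)) / c1 <= (1 + B) / M.
  apply: (@le_trans _ _ ((1 + B) / c1)); last by rewrite ler_wpM2l//; lra.
  by rewrite ler_wpM2r ?(ltW c1i)//; move: HB; rewrite ler_norml; lra.
have E2 : B * (1 + c2^-1) / c1 <= B * 2 / M.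
  apply: (@le_trans _ _ (B * 2 / c1)); last by rewrite ler_wpM2l//; lra.
  rewrite ler_wpM2r ?(ltW c1i)// ler_wpM2l//.
  suff : c2^-1 <= 1 by lra.
  by rewrite invf_le1//; lra.
rewrite !mulrDl; move: E1 E2 I1; rewrite mulrDl; lra.
Qed.

Lemma expect_add_vertexE n h :
  ew n.+1 h = ew n (thin p%:num h) + q ^+ n * ew n (fdiff h).
Proof. by rewrite expect_add_vertex expectD expectZ. Qed.

Lemma expect_succf n h : ew n (succf h) = ew n h + ew n (fdiff h).
Proof.
by rewrite -expectD; congr (ew n _); apply/funext => w; rewrite /succf /fdiff; ring.
Qed.

Lemma bias_gap_step n h :
  bias_gap n h = - ((1 - q ^+ n) * ew n (fdiff h)) - (ew n h - ew n (thin p%:num h)).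
Proof. rewrite /bias_gap expect_add_vertexE expect_succf; ring. Qed.

(** A vertex is added in both expectations of the gap. The term with factor p arises because shift
    and thinning do not commute: the shift of [thin p h] is a mixture, with weights p and q, of
    [thin p h] and [thin p (succf h)]. *)
Lemma bias_gap_add_vertex n h :
  bias_gap n.+1 h = bias_gap n (thin p%:num h) + q ^+ n.+1 * bias_gap n (fdiff h)
    - p%:num * (ew n (thin p%:num (fdiff h)) + q ^+ n * ew n (succf (fdiff h))).
Proof.
have S : ew n (succf (thin p%:num h)) =
    p%:num * ew n (thin p%:num h) + q * ew n (thin p%:num (succf h)).
  by rewrite -expect_lin.
have D : ew n (thin p%:num (fdiff h)) =
    ew n (thin p%:num (succf h)) - ew n (thin p%:num h).
  by rewrite -expectB; congr (ew n _); apply/funext => w; rewrite thin_fdiff.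
rewrite /bias_gap [ew n.+2 h]expect_add_vertexE [ew n.+1 (succf h)]expect_add_vertexE S D.
rewrite exprS -[fdiff (succf h)]/(succf (fdiff h)); ring.
Qed.

Lemma is_derive_expect n (f : R -> nat -> R) (df : nat -> R) (t : R) :
  (forall w, is_derive t 1 (fun u => f u w) (df w)) ->
  is_derive t 1 (fun u => ew n (f u)) (ew n df).
Proof.
move=> fdf; rewrite /expect.
have -> : (fun u => \sum_(G : graph n) er_pmf p G * f u (num_isolated G)) =
    \sum_(G : graph n) (fun u => er_pmf p G * f u (num_isolated G)).
  by apply/funext => u; rewrite fct_sumE.
elim/big_ind2 : _ => [|f1 d1 f2 d2 D1 D2|G _].
- exact: is_derive_cst.
- exact: is_deriveD.
- exact: is_deriveZ.
Qed.

Lemma derivative_thin_expect n h (t : R) :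
  is_derive t 1 (fun u => ew n.+1 (thin u h)) (- (mu n.+1 * ew n (thin t (fdiff h)))).
Proof.
have H := is_derive_expect n.+1 (fun w => is_derive_thin t h w).
apply: (is_derive_eq H).
rewrite expectN (expect_size_bias p n (fun w => thin t (fdiff h) w.-1)) //.
Qed.

(** In the second expectation the derivative carries w + 1; size biasing absorbs w, and the
    remaining 1 joins the discrepancy of the two means in the last term. *)
Lemma derivative_thin_bias_gap n h (t : R) :
  is_derive t 1 (fun u => bias_gap n.+1 (thin u h))
   (- (mu n.+1 * bias_gap n (thin t (fdiff h))
      + (mu n.+2 - mu n.+1 - 1) * ew n.+1 (thin t (fdiff h)))).
Proof.
have H := is_deriveB (derivative_thin_expect n.+1 h t)
  (is_derive_expect n.+1 (fun w => is_derive_thin t h w.+1)).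
apply: (is_derive_eq H); rewrite /=.
have -> : (fun w : nat => - (w.+1%:R * thin t (fdiff h) w)) =
    (fun w => -1 * (w%:R * thin t (fdiff h) w) + -1 * thin t (fdiff h) w).
  by apply/funext => w; rewrite -addn1 natrD; ring.
rewrite expect_lin expect_size_bias /bias_gap; ring.
Qed.

Lemma mean_value (f df : R -> R) (b : R) : 0 < b ->
  (forall t : R, is_derive t 1 f (df t)) ->
  exists2 t, 0 <= t <= b & f 0 - f b = - (b * df t).
Proof.
move=> b0 fdf.
have cf : {within `[0, b], continuous f}.
  by apply: derivable_within_continuous => x _; apply: ex_derive.
have [c] := MVT b0 (fun x _ => fdf x) cf.
rewrite in_itv/= => /andP[c0 cb] E; exists c; first by rewrite !ltW.
by rewrite -opprB E; ring.
Qed.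

(** Thinning with parameter 0 is the identity. With b = p this produces the factor p mu of the
    contraction rate. *)
Lemma expect_thin_mean_value n h b : 0 < b -> exists2 t, 0 <= t <= b &
  ew n.+1 h - ew n.+1 (thin b h) = b * (mu n.+1 * ew n (thin t (fdiff h))).
Proof.
move=> b0; have [t tb] := mean_value b0 (derivative_thin_expect n h).
have -> : thin 0 h = h by apply/funext => w; rewrite thin0.
by rewrite mulrN opprK; exists t.
Qed.

Lemma bias_gap_thin_mean_value n h b : 0 < b -> exists2 t, 0 <= t <= b &
  bias_gap n.+1 h - bias_gap n.+1 (thin b h) =
  b * (mu n.+1 * bias_gap n (thin t (fdiff h))
      + (mu n.+2 - mu n.+1 - 1) * ew n.+1 (thin t (fdiff h))).
Proof.
move=> b0; have [t tb] := mean_value b0 (derivative_thin_bias_gap n h).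
have -> : thin 0 h = h by apply/funext => w; rewrite thin0.
by rewrite mulrN opprK; exists t.
Qed.

End expectation.

(** * Smoothing estimates by contraction *)

Section smoothing.
Context {R : realType}.
Variable p : {i01 R}.
Notation q := (1 - p%:num : R).
Notation ew := (expect p).
Notation mu := (iso_mean p).
Notation dw := (bias_gap p).
Implicit Types (h : nat -> R) (t : R).

Definition unit_ball (h : nat -> R) := forall w, `|h w| <= 1.

(* [p * mu m / q ^+ 2] is the contraction rate in the smoothing estimates. *)
Definition regular (M B g : R) (m : nat) :=
  [/\ M <= mu m, mu m <= B * M, `|mu m.+1 - mu m| <= B &
      g <= 1 - q ^+ m - p%:num * mu m / q ^+ 2].

(** [M] is the common scale of the means, [B] collects constants and [g] is the room left by the
    contraction rate; [p * M <= B] makes errors of order p into O(1/M). *)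
Definition setting (M B g : R) :=
  [/\ 1 <= M, 1 <= B & 0 < g <= 1] /\ [/\ 0 < p%:num, p%:num < 1 & p%:num * M <= B].

Context {M B g : R}.

Lemma settingP : setting M B g ->
  [/\ 1 <= M, 1 <= B, 0 < g, g <= 1 & [/\ 0 < p%:num, 0 < q, q <= 1, 0 < M & p%:num * M <= B]].
Proof.
by move=> [[M1 B1 /andP[g0 g1]] [p0 p1 pM]]; do !split => //; lra.
Qed.

Definition tau : R := (3 * B + 2) / M.

Lemma q_expr k : 0 <= q ^+ k <= 1.
Proof. by rewrite exprn_ge0 ?exprn_ile1 ?subr_ge0 ?lerBlDr ?lerDl. Qed.

Lemma regular_rate m : setting M B g -> regular M B g m -> 0 <= p%:num * mu m / q ^+ 2 <= 1.
Proof.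
move=> HS0; have [M1 B1 g0 g1 [p0 q0 q1 M0 pM]] := settingP HS0.
case=> Mm _ _ gap; rewrite divr_ge0 ?mulr_ge0 ?mu_ge0 ?sqr_ge0//=.
have : 0 <= q ^+ m by rewrite exprn_ge0// ltW.
by move: gap; lra.
Qed.

Lemma pmu_le m : setting M B g -> regular M B g m -> 0 <= p%:num * mu m <= 1.
Proof.
move=> HS0; have [M1 B1 g0 g1 [p0 q0 q1 M0 pM]] := settingP HS0.
move=> /(regular_rate HS0)/andP[]; rewrite ler_pdivlMr ?exprn_gt0// mul0r => ->.
rewrite ler_pdivrMr ?exprn_gt0// mul1r => /le_trans -> //; rewrite exprn_ile1// ltW.
Qed.

Lemma rate_le m : setting M B g -> regular M B g m -> p%:num * mu m / q <= p%:num * mu m / q ^+ 2.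
Proof.
move=> HS0; have [M1 B1 g0 g1 [p0 q0 q1 M0 pM]] := settingP HS0.
move=> /(pmu_le HS0)/andP[pm _]; rewrite ler_wpM2l// lef_pV2 ?posrE ?exprn_gt0//.
by rewrite expr2 ler_piMl// ltW.
Qed.

Lemma thin_fdiffE t h w : 1 - t != 0 ->
  thin t (fdiff h) w = (1 - t)^-1 * fdiff (thin t h) w.
Proof. by move=> t1; rewrite fdiff_thin mulKf. Qed.

Lemma thin_unit t h c : 0 <= t <= p%:num -> (forall w, `|h w| <= c) ->
  forall w, `|thin t h w| <= c.
Proof.
move=> /andP[t0 tp] h1 w; apply: norm_thin => //.
by rewrite t0 (le_trans tp).
Qed.

Lemma unit_thin t h : 0 <= t <= p%:num -> unit_ball h -> unit_ball (thin t h).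
Proof. exact: thin_unit. Qed.

Lemma invq_le t : 0 < q -> 0 <= t <= p%:num -> 0 < (1 - t)^-1 <= q^-1.
Proof.
move=> q0 /andP[t0 tp]; apply/andP; split; first by rewrite invr_gt0; lra.
by rewrite lef_pV2 ?posrE; lra.
Qed.

Lemma unit_fdiff h : unit_ball h -> forall w, `|fdiff h w| <= 2.
Proof. by move=> h1 w; rewrite -[2]mulr1; exact: norm_fdiff. Qed.

(** Pulling two differences out of the thinning costs (1 - t)^-2, and the thinned function stays in
    the unit ball. This is the source of the q^2 in [regular]. *)
Lemma expect_thin_fdiff2 n t (S : R) : 0 < q -> 0 <= t <= p%:num ->
  (forall h, unit_ball h -> `|ew n (fdiff (fdiff h))| <= S) ->
  forall h, unit_ball h -> `|ew n (thin t (fdiff (fdiff h)))| <= (q ^+ 2)^-1 * S.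
Proof.
move=> q0 tp HS h h1; have [/andP[t0 tp'] /andP[iq0 iq]] := (tp, invq_le q0 tp).
have -> : thin t (fdiff (fdiff h)) =
    (fun w => (1 - t)^-2 * fdiff (fdiff (thin t h)) w).
  have n0 : 1 - t != 0 by lra.
  apply/funext => w; rewrite thin_fdiffE// {1}/fdiff !thin_fdiffE// [in RHS]/fdiff.
  by rewrite -exprVn /fdiff; ring.
rewrite expectZ normrM -exprVn (ger0_norm (sqr_ge0 _)); apply: ler_pM => //.
- exact: sqr_ge0.
- by rewrite -exprVn ler_pXn2r// nnegrE ltW// invr_gt0.
- exact: HS _ (unit_thin tp h1).
Qed.

(** A preimage of [h] under [succf] with the same bound, used to transfer estimates to one vertex
    less; at 0 it takes the value [h 0]. *)
Definition backshift (h : nat -> R) : nat -> R := fun w => h w.-1.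

Lemma unit_backshift h : unit_ball h -> unit_ball (backshift h).
Proof. by move=> h1 w; exact: h1. Qed.

Lemma bias_gap_smooth_pred i U : setting M B g -> regular M B g i.+1 -> regular M B g i.+2 ->
  (forall h, unit_ball h -> `|dw i.+1 (fdiff h)| <= U) ->
  forall h, unit_ball h -> `|dw i (fdiff h)| <= U + 2 * tau.
Proof.
move=> HS0; have [M1 B1 g0 g1 [p0 q0 q1 M0 pM]] := settingP HS0.
move=> [M1' _ D1 _] [M2' _ _ _] HU h h1.
have := HU _ (unit_backshift h1).
have := bias_gap_second_difference_le M1 M1' M2' D1 (unit_fdiff (unit_backshift h1)).
rewrite -[fdiff h]/(succf (fdiff (backshift h))) -/tau !ler_norml; lra.
Qed.

(** [bias_gap_add_vertex] and the mean value formula bound 1 - q^(i+2) times the gap by O(1/M) plus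
    p mu / q times a gap of the same kind on one vertex less; [bias_gap_smooth_pred] restores the
    vertex count. *)
Lemma bias_gap_smooth i : setting M B g ->
  regular M B g i.+1 -> regular M B g i.+2 -> regular M B g i.+3 ->
  forall h, unit_ball h -> `|dw i.+1 (fdiff h)| <= 23 * B ^+ 2 / M / g.
Proof.
move=> HS0; have [M1 B1 g0 g1 [p0 q0 q1 M0 pM]] := settingP HS0.
move=> R1 R2 R3.
have tau0 : 0 <= tau by rewrite divr_ge0//; lra.
have B0 : 0 <= B by lra.
have pB : p%:num <= B / M by rewrite ler_pdivlMr.
have rate := regular_rate HS0 R1.
have iM : 0 < M^-1 by rewrite invr_gt0.
(* The left side is at most (2 B^2 + 15 B + 6) / M, and 2 + 15 + 6 = 23. *)
have A_le : 3 * tau + p%:num * (2 * B + 6) <= 23 * B ^+ 2 / M.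
  have : p%:num * (2 * B + 6) <= B / M * (2 * B + 6) by rewrite ler_wpM2r//; lra.
  suff : 0 <= 23 * B ^+ 2 / M - (3 * tau + B / M * (2 * B + 6)) by lra.
  have -> : 23 * B ^+ 2 / M - (3 * tau + B / M * (2 * B + 6)) =
      (B - 1) * (21 * B + 6) / M by rewrite /tau; field; rewrite gt_eqF.
  by rewrite !mulr_ge0 ?(ltW iM)//; lra.
apply: (@le_contraction _ _ unit_ball (fun h => dw i.+1 (fdiff h))
  (1 - q ^+ i.+2) (p%:num * mu i.+1 / q) _ g 4 g0).
- by rewrite divr_ge0 ?(ltW q0)// mulr_ge0 ?mu_ge0// ltW.
- case: (R1) => _ _ _ gap; have := rate_le HS0 R1.
  have : q ^+ i.+2 <= q ^+ i.+1.
    by rewrite [q ^+ i.+2]exprS ler_piMl// exprn_ge0// ltW.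
  by move: gap; lra.
- by rewrite divr_ge0 ?mulr_ge0 ?sqr_ge0 ?(ltW M0).
- by move=> h h1; have := norm_bias_gap p i.+1 (unit_fdiff h1); lra.
move=> U U0 HU h h1.
have [t tp E] := bias_gap_thin_mean_value p i h p0.
have S := bias_gap_add_vertex p i.+1 h.
have T : `|dw i.+2 h - dw i.+1 (succf h)| <= tau.
  case: R2 => m2 _ D2 _; case: R3 => m3 _ _ _.
  by rewrite -[tau]mul1r; exact: bias_gap_second_difference_le M1 m2 m3 D2 h1.
have sE : dw i.+1 (succf h) = dw i.+1 h + dw i.+1 (fdiff h).
  by rewrite -bias_gapD; congr (dw _ _); apply/funext => w; rewrite /succf /fdiff; ring.
have K2 := thin_unit tp (unit_fdiff h1).
have e1 : `|p%:num * (ew i.+1 (thin p%:num (fdiff h)) + q ^+ i.+1 * ew i.+1 (succf (fdiff h)))|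
    <= p%:num * 4.
  rewrite normrM (gtr0_norm p0) ler_wpM2l ?(ltW p0)//.
  have pp : 0 <= p%:num <= (p%:num : R) by rewrite lexx ltW.
  have n1 := norm_expect p i.+1 (thin_unit pp (unit_fdiff h1)).
  have n2 : `|ew i.+1 (succf (fdiff h))| <= 2.
    by apply: norm_expect => w; exact: unit_fdiff.
  have n3 : `|q ^+ i.+1 * ew i.+1 (succf (fdiff h))| <= 2.
    rewrite normrM -[2]mul1r; apply: ler_pM => //.
    by case/andP: (q_expr i.+1) => ? ?; rewrite ger0_norm.
  by apply: (le_trans (ler_normD _ _)); lra.
have e2 : `|(mu i.+2 - mu i.+1 - 1) * ew i.+1 (thin t (fdiff h))| <= (B + 1) * 2.
  rewrite normrM; apply: ler_pM => //; last exact: norm_expect.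
  case: R1 => _ _ D1 _; apply: (le_trans (ler_normB _ _)).
  by rewrite normr1; lra.
have e3 : `|dw i (thin t (fdiff h))| <= q^-1 * (U + 2 * tau).
  have [/andP[t0 tp'] /andP[iq0 iq]] := (tp, invq_le q0 tp).
  have -> : thin t (fdiff h) = (fun w => (1 - t)^-1 * fdiff (thin t h) w).
    by apply/funext => w; rewrite thin_fdiffE//; lra.
  rewrite bias_gapZ normrM (gtr0_norm iq0); apply: ler_pM => //; first exact: ltW.
  exact: bias_gap_smooth_pred HS0 R1 R2 HU _ (unit_thin tp h1).
have e4 : `|dw i.+1 h - dw i.+1 (thin p%:num h)| <=
    p%:num * mu i.+1 / q * U + 2 * tau + p%:num * ((B + 1) * 2).
  rewrite E normrM (gtr0_norm p0).
  apply: (@le_trans _ _ (p%:num * (mu i.+1 * (q^-1 * (U + 2 * tau)) + (B + 1) * 2))).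
    rewrite ler_wpM2l ?(ltW p0)//; apply: (le_trans (ler_normD _ _)); apply: lerD => //.
    by rewrite normrM ger0_norm ?mu_ge0// ler_wpM2l ?mu_ge0.
  have : p%:num * mu i.+1 / q * (2 * tau) <= 2 * tau.
    rewrite ler_piMl ?mulr_ge0//; have := rate_le HS0 R1; move: rate => /andP[]; lra.
  rewrite mulrDr [X in _ -> X + _ <= _](_ : _ =
    p%:num * mu i.+1 / q * U + p%:num * mu i.+1 / q * (2 * tau)); [lra | ring].
(* This is [bias_gap_add_vertex] solved for the gap of [fdiff h], after splitting [succf h] as
   [h + fdiff h]. *)
have EE : (1 - q ^+ i.+2) * dw i.+1 (fdiff h) =
    - (dw i.+2 h - dw i.+1 (succf h)) - (dw i.+1 h - dw i.+1 (thin p%:num h))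
    - p%:num * (ew i.+1 (thin p%:num (fdiff h)) + q ^+ i.+1 * ew i.+1 (succf (fdiff h))).
  by rewrite S sE; ring.
have qi : 0 <= 1 - q ^+ i.+2 by rewrite subr_ge0; case/andP: (q_expr i.+2).
rewrite -{1}(ger0_norm qi) -normrM EE.
apply: (le_trans (ler_normB _ _)).
apply: (@le_trans _ _ (tau +
  (p%:num * mu i.+1 / q * U + 2 * tau + p%:num * ((B + 1) * 2)) + p%:num * 4)).
  apply: lerD => //; apply: (le_trans (ler_normB _ _)); rewrite normrN; exact: lerD.
move: A_le; rewrite mulrDr; lra.
Qed.

(** The same contraction, from [bias_gap_step] at [fdiff h]. In [3 U], one [U] bounds the gap and
    two pay for the change of vertex count. *)
Lemma expect_smooth2 i : setting M B g -> regular M B g i.+1 -> regular M B g i.+2 ->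
  regular M B g i.+3 -> regular M B g i.+4 ->
  forall h, unit_ball h ->
    `|ew i.+2 (fdiff (fdiff h))| <= 3 * (23 * B ^+ 2 / M / g) / g.
Proof.
move=> HS0; have [M1 B1 g0 g1 [p0 q0 q1 M0 pM]] := settingP HS0.
move=> R1 R2 R3 R4.
have U1 := bias_gap_smooth HS0 R1 R2 R3.
have U2 := bias_gap_smooth HS0 R2 R3 R4.
set U := 23 * B ^+ 2 / M / g in U1 U2 *.
have U0 : 0 <= U by rewrite divr_ge0 ?(ltW g0)// divr_ge0 ?(ltW M0)// mulr_ge0// sqr_ge0.
clearbody U.
have rate := regular_rate HS0 R2.
apply: (@le_contraction _ _ unit_ball (fun h => ew i.+2 (fdiff (fdiff h)))
  (1 - q ^+ i.+2) (p%:num * mu i.+2 / q ^+ 2) _ g 4 g0).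
- by case/andP: rate.
- by case: (R2).
- by rewrite mulr_ge0.
- move=> h h1; apply: norm_expect => w.
  by have := norm_fdiff (unit_fdiff h1) w; lra.
move=> S S0 HS h h1.
have SE := bias_gap_step p i.+2 (fdiff h).
have [t tp E] := expect_thin_mean_value p i.+1 (fdiff h) p0.
have e3 : `|ew i.+1 (thin t (fdiff (fdiff h)))| <= (q ^+ 2)^-1 * (S + 2 * U).
  apply: expect_thin_fdiff2 => // f f1.
  have := HS _ (unit_backshift f1).
  have : `|dw i.+1 (fdiff (fdiff (backshift f)))| <= 2 * U.
    (* Halving returns the first difference to the unit ball, where [U1] applies. *)
    have -> : fdiff (fdiff (backshift f)) =
        (fun w => 2 * fdiff (fun v => fdiff (backshift f) v / 2) w).
      by apply/funext => w; rewrite /fdiff; field.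
    rewrite bias_gapZ normrM ger0_norm// ler_wpM2l//; apply: U1 => w.
    have := unit_fdiff (unit_backshift f1) w.
    by rewrite normrM (ger0_norm (x := 2^-1))//; lra.
  rewrite /bias_gap -[succf _]/(fdiff (fdiff f)) !ler_norml; lra.
have qi : 0 <= 1 - q ^+ i.+2 by rewrite subr_ge0; case/andP: (q_expr i.+2).
rewrite -{1}(ger0_norm qi) -normrM.
have -> : (1 - q ^+ i.+2) * ew i.+2 (fdiff (fdiff h)) =
   - dw i.+2 (fdiff h) - (ew i.+2 (fdiff h) - ew i.+2 (thin p%:num (fdiff h))).
  by rewrite SE; ring.
apply: (le_trans (ler_normB _ _)); rewrite normrN E.
have D2 := U2 _ h1.
have : `|p%:num * (mu i.+2 * ew i.+1 (thin t (fdiff (fdiff h))))| <=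
    p%:num * mu i.+2 / q ^+ 2 * (S + 2 * U).
  rewrite mulrA normrM ger0_norm ?mulr_ge0 ?mu_ge0 ?(ltW p0)//.
  by rewrite -[leRHS]mulrA ler_wpM2l// mulr_ge0 ?mu_ge0 ?ltW.
have : p%:num * mu i.+2 / q ^+ 2 * (2 * U) <= 2 * U.
  by rewrite ler_piMl ?mulr_ge0//; case/andP: rate.
rewrite mulrDr; lra.
Qed.

(** With n = i + 4, the gap is minus a combination, with weights 1 - q^n and p mu_n, of means of
    [fdiff h] over n vertices and, thinned, over n - 1. Moving both to n + 1 vertices without
    thinning costs only smoothed quantities. The total weight is variance over mean, as Stein's
    method requires. *)
Lemma bias_gap_expansion i : setting M B g -> (forall m, (i < m <= i + 6)%N -> regular M B g m) ->
  forall h, unit_ball h ->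
  `|dw i.+4 h + (1 - q ^+ i.+4 + p%:num * mu i.+4) * ew i.+4.+1 (fdiff h)| <=
  345 * B ^+ 2 / g ^+ 2 / M.
Proof.
move=> HS0; have [M1 B1 g0 g1 [p0 q0 q1 M0 pM]] := settingP HS0.
move=> reg h h1.
have R1 : regular M B g i.+1 by apply: reg; clear; lia.
have R2 : regular M B g i.+2 by apply: reg; clear; lia.
have R3 : regular M B g i.+3 by apply: reg; clear; lia.
have R4 : regular M B g i.+4 by apply: reg; clear; lia.
have R5 : regular M B g i.+4.+1 by apply: reg; clear; lia.
have R6 : regular M B g i.+4.+2 by apply: reg; clear; lia.
have U3 := bias_gap_smooth HS0 R3 R4 R5 h1.
have U4 := bias_gap_smooth HS0 R4 R5 R6 h1.
have S3 := expect_smooth2 HS0 R2 R3 R4 R5 h1.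
have S4 := expect_smooth2 HS0 R3 R4 R5 R6 h1.
have S2 := expect_smooth2 HS0 R1 R2 R3 R4.
have KE : 345 * B ^+ 2 / g ^+ 2 / M = 15 * (23 * B ^+ 2 / M / g) / g.
  by field; rewrite !gt_eqF.
rewrite KE; set U := 23 * B ^+ 2 / M / g in U3 U4 S2 S3 S4 *.
have U0 : 0 <= U by rewrite divr_ge0 ?(ltW g0)// divr_ge0 ?(ltW M0)// mulr_ge0// sqr_ge0.
set S := 3 * U / g in S2 S3 S4.
have S0 : 0 <= S by rewrite divr_ge0 ?(ltW g0)// mulr_ge0.
have -> : 15 * U / g = 5 * S by rewrite /S; ring.
have US : 3 * U <= S by rewrite ler_pdivlMr// ler_piMr// mulr_ge0.
clearbody S U.
have SE := bias_gap_step p i.+4 h.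
have [t tp E] := expect_thin_mean_value p i.+3 h p0.
have [s sp E2] : exists2 s, 0 <= s <= p%:num & `|ew i.+3 (fdiff h) - ew i.+3 (thin t (fdiff h))| <=
    p%:num * (mu i.+3 * `|ew i.+2 (thin s (fdiff (fdiff h)))|).
  (* The mean value formula needs an interval of positive length, so t = 0 is separate. *)
  have /andP[] := tp; rewrite le_eqVlt => /orP[/eqP<- _|t0 tp'].
    exists 0; first by rewrite lexx ltW.
    have -> : thin 0 (fdiff h) = fdiff h by apply/funext => w; rewrite thin0.
    by rewrite subrr normr0 mulr_ge0 ?(ltW p0)// mulr_ge0 ?mu_ge0.
  have [s /andP[s0 st] E2] := expect_thin_mean_value p i.+2 (fdiff h) t0.
  exists s; first by rewrite s0; lra.
  rewrite E2 normrM (gtr0_norm t0) normrM (ger0_norm (mu_ge0 p _)).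
  by rewrite ler_wpM2r// mulr_ge0 ?mu_ge0.
have e3 : `|ew i.+2 (thin s (fdiff (fdiff h)))| <= (q ^+ 2)^-1 * S.
  exact: expect_thin_fdiff2.
have e4 : `|ew i.+3 (fdiff h) - ew i.+3 (thin t (fdiff h))| <= S.
  apply: (le_trans E2); apply: (@le_trans _ _ (p%:num * (mu i.+3 * ((q ^+ 2)^-1 * S)))).
    by rewrite ler_wpM2l ?(ltW p0)// ler_wpM2l ?mu_ge0.
  have -> : p%:num * (mu i.+3 * ((q ^+ 2)^-1 * S)) = p%:num * mu i.+3 / q ^+ 2 * S.
    by rewrite -!mulrA.
  by rewrite ler_piMl//; case/andP: (regular_rate HS0 R3).
have T4 : ew i.+4.+1 (fdiff h) = ew i.+4 (fdiff h) + ew i.+4 (fdiff (fdiff h)) + dw i.+4 (fdiff h).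
  by rewrite -expect_succf /bias_gap; ring.
have T3 : ew i.+4 (fdiff h) = ew i.+3 (fdiff h) + ew i.+3 (fdiff (fdiff h)) + dw i.+3 (fdiff h).
  by rewrite -expect_succf /bias_gap; ring.
rewrite SE E.
set a := 1 - q ^+ i.+4; set b := p%:num * mu i.+4.
have a01 : 0 <= a <= 1.
  have : 0 <= q ^+ i.+4 <= 1 by exact: q_expr.
  by rewrite /a; lra.
have b01 : 0 <= b <= 1 := pmu_le HS0 R4.
(* [x4] and [x3] are the errors of the two moves; in total 2 (S + U) + (2 S + U) <= 5 S. *)
pose x4 := ew i.+4 (fdiff (fdiff h)) + dw i.+4 (fdiff h).
pose x3 := ew i.+3 (fdiff (fdiff h)) + dw i.+3 (fdiff h) +
  (ew i.+3 (fdiff h) - ew i.+3 (thin t (fdiff h))).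
have -> : - (a * ew i.+4 (fdiff h)) - p%:num * (mu i.+4 * ew i.+3 (thin t (fdiff h))) +
   (a + b) * ew i.+4.+1 (fdiff h) = (a + b) * x4 + b * x3.
  by rewrite T4 T3 /x4 /x3 /b; ring.
have X4 : `|x4| <= S + U by apply: (le_trans (ler_normD _ _)); lra.
have X3 : `|x3| <= 2 * S + U.
  apply: (le_trans (ler_normD _ _)).
  have := ler_normD (ew i.+3 (fdiff (fdiff h))) (dw i.+3 (fdiff h)).
  lra.
have ab : 0 <= a + b <= 2 by lra.
have : `|(a + b) * x4| <= 2 * (S + U).
  by rewrite normrM; apply: ler_pM => //; rewrite ger0_norm; lra.
have : `|b * x3| <= 1 * (2 * S + U).
  by rewrite normrM; apply: ler_pM => //; rewrite ger0_norm; lra.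
have := ler_normD ((a + b) * x4) (b * x3); lra.
Qed.

End smoothing.

(** * Stein's equation for the Poisson distribution *)

Section poisson_stein.
Context {R : realType}.
Variable m : R.
Hypothesis m_gt0 : 0 < m.

Definition pois (k : nat) : R := m ^+ k / k`!%:R * expR (- m).

Definition pois_cdf (k : nat) : R := \sum_(i < k.+1) pois i.

Lemma pois_gt0 k : 0 < pois k.
Proof. by rewrite /pois mulr_gt0 ?expR_gt0// divr_gt0 ?exprn_gt0// ltr0n fact_gt0. Qed.

Lemma poisS k : k.+1%:R * pois k.+1 = m * pois k.
Proof.
rewrite /pois factS natrM exprS; field.
by rewrite nat1r !pnatr_eq0 -lt0n fact_gt0.
Qed.

Lemma pois_cdfS k : pois_cdf k.+1 = pois_cdf k + pois k.+1.
Proof. by rewrite /pois_cdf big_ord_recr. Qed.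

Lemma pois_cdfE k : pois_cdf k = series (exp_coeff m) k.+1 * expR (- m).
Proof. by rewrite /pois_cdf /series /= big_mkord mulr_suml. Qed.

Lemma pois_cdf_ge0 k : 0 <= pois_cdf k.
Proof. by apply: sumr_ge0 => i _; rewrite ltW ?pois_gt0. Qed.

Lemma pois_cdf_le1 k : pois_cdf k <= 1.
Proof.
rewrite pois_cdfE expRN ler_pdivrMr ?expR_gt0// mul1r.
apply: nondecreasing_cvgn_le; last exact: is_cvg_series_exp_coeff.
by apply: nondecreasing_series => i _ _; exact: exp_coeff_ge0 (ltW m_gt0).
Qed.

Lemma pois_le_cdf k : pois k <= pois_cdf k.
Proof.
rewrite /pois_cdf big_ord_recr /= lerDr.
by apply: sumr_ge0 => i _; rewrite ltW ?pois_gt0.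
Qed.

(** Convergence of the distribution function to 1, in a form that bounds upper tails through finite
    sums. *)
Lemma pois_cdf_sup (Y : R) : (forall k, pois_cdf k <= Y) -> 1 <= Y.
Proof.
move=> H; rewrite -(ler_pM2l (expR_gt0 m)) mulr1 {1}/expR.
apply: limr_le; first exact: is_cvg_series_exp_coeff.
exists 1%N => // -[//|k] _ /=.
have := H k; rewrite pois_cdfE expRN ler_pdivrMr ?expR_gt0//.
by rewrite mulrC.
Qed.

(** For i <= k, m pois(i) = (i + 1) pois(i + 1) <= (k + 1) pois(i + 1); after summation the term
    [pois 0] is to spare. *)
Lemma pois_cdf_ratio k : pois_cdf k / pois k <= pois_cdf k.+1 / pois k.+1.
Proof.
have k0 : 0 < k.+1%:R :> R by rewrite ltr0n.
have E : pois k = k.+1%:R * pois k.+1 / m by rewrite poisS mulrAC divff ?mul1r ?gt_eqF.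
have -> : pois_cdf k / pois k = m * pois_cdf k / k.+1%:R / pois k.+1.
  by rewrite E; field; rewrite nat1r pnatr_eq0 !gt_eqF ?pois_gt0.
rewrite ler_wpM2r ?invr_ge0 ?(ltW (pois_gt0 _))// ler_pdivrMr//.
rewrite /pois_cdf [in leRHS]big_ord_recl mulrDl /= mulr_sumr [in leRHS]mulr_suml.
rewrite -[leLHS]add0r lerD ?mulr_ge0 ?(ltW (pois_gt0 _))//.
apply: ler_sum => i _; rewrite -poisS mulrC /bump /= add1n.
by rewrite ler_wpM2l ?(ltW (pois_gt0 _))// ler_nat ltnS -ltnS.
Qed.

(** The same index shift above k, where (k + 1) pois(i + 1) <= (i + 1) pois(i + 1) = m pois(i). *)
Lemma pois_tail_partial k N : k.+1%:R * (pois_cdf (k + N).+1 - pois_cdf k.+1) <=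
  m * (pois_cdf (k + N) - pois_cdf k).
Proof.
elim: N => [|N IH]; first by rewrite addn0 !subrr !mulr0.
rewrite addnS !(pois_cdfS (k + N)) (pois_cdfS (k + N).+1).
have := poisS (k + N).+1.
have : k.+1%:R * pois (k + N).+2 <= (k + N).+2%:R * pois (k + N).+2.
  by rewrite ler_wpM2r ?(ltW (pois_gt0 _))// ler_nat; lia.
move: IH; rewrite (pois_cdfS (k + N)) => IH H1 H2; move: IH H1; rewrite H2 !mulrBr !mulrDr; lra.
Qed.

Lemma pois_tail_step k : k.+1%:R * (1 - pois_cdf k.+1) <= m * (1 - pois_cdf k).
Proof.
have k0 : 0 < k.+1%:R :> R by rewrite ltr0n.
rewrite mulrC -ler_pdivlMr// lerBlDr; apply: pois_cdf_sup => N.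
rewrite -lerBlDr ler_pdivlMr// mulrC.
have [Nk|kN] := leqP N k.
  apply: (@le_trans _ _ 0).
    rewrite mulr_ge0_le0 ?(ltW k0)// subr_le0 /pois_cdf (big_ord_widen k.+2); last by lia.
    rewrite [leLHS]big_mkcond; apply: ler_sum => i _; case: ifP => // _; exact/ltW/pois_gt0.
  by rewrite mulr_ge0 ?(ltW m_gt0)// subr_ge0 pois_cdf_le1.
have := pois_tail_partial k (N - k.+1).
have -> : (k + (N - k.+1)).+1 = N by lia.
move/le_trans; apply; rewrite ler_wpM2l ?(ltW m_gt0)// lerD2r; exact: pois_cdf_le1.
Qed.

Lemma pois_tail_ratio k : (1 - pois_cdf k.+1) / pois k.+1 <= (1 - pois_cdf k) / pois k.
Proof.
have E : pois k = k.+1%:R * pois k.+1 / m by rewrite poisS mulrAC divff ?mul1r ?gt_eqF.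
have -> : (1 - pois_cdf k) / pois k = m * (1 - pois_cdf k) / k.+1%:R / pois k.+1.
  by rewrite E; field; rewrite nat1r pnatr_eq0 !gt_eqF ?pois_gt0.
rewrite ler_wpM2r ?invr_ge0 ?(ltW (pois_gt0 _))// ler_pdivlMr ?ltr0n// mulrC.
exact: pois_tail_step.
Qed.

(** For Z Poisson, the value at j + 1 is (P[Z = a, Z <= j] - P[Z = a] P[Z <= j]) / (m P[Z = j]),
    which solves Stein's equation for the indicator of [a]. *)
Definition stein_sol (a k : nat) : R :=
  if k is j.+1 then
    (if (j < a)%N then - (pois a * pois_cdf j) else pois a * (1 - pois_cdf j))
    / (m * pois j)
  else 0.

Lemma stein_solP a k :
  m * stein_sol a k.+1 - k%:R * stein_sol a k = (k == a)%:R - pois a.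
Proof.
have p0 j : pois j != 0 by rewrite gt_eqF ?pois_gt0.
have m0 : m != 0 by rewrite gt_eqF.
case: k => [|j].
  rewrite mul0r subr0 /= /pois_cdf big_ord1; case: a => [|a] /=; first by field; rewrite m0 p0.
  by field; rewrite m0 p0.
have -> : j.+1%:R * stein_sol a j.+1 =
   (if (j < a)%N then - (pois a * pois_cdf j) else pois a * (1 - pois_cdf j)) / pois j.+1.
  rewrite /stein_sol -poisS; set F := if _ then _ else _; field.
  by rewrite p0 nat1r pnatr_eq0.
rewrite /stein_sol pois_cdfS.
case: (ltngtP j.+1 a) => [ja|aj|<-].
- by rewrite mulr0n; field; rewrite m0 p0.
- by rewrite mulr0n; field; rewrite m0 p0.
- by rewrite mulr1n; field; rewrite m0 p0.
Qed.

(** By monotonicity of the two ratios, m times the solution is largest in absolute value when j is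
    replaced by [a]; [pois a] then cancels and a probability is left. *)
Lemma norm_stein_sol a k : `|stein_sol a k| <= m^-1.
Proof.
have m1 : 0 < m^-1 by rewrite invr_gt0.
case: k => [|j] /=; first by rewrite normr0 ltW.
set F := if _ then _ else _.
rewrite normrM normfV (gtr0_norm (mulr_gt0 m_gt0 (pois_gt0 j))) invfM mulrCA ler_piMr ?(ltW m1)//.
rewrite /F; case: ltnP => [ja|aj].
  rewrite normrN (ger0_norm (mulr_ge0 (ltW (pois_gt0 a)) (pois_cdf_ge0 j))) -mulrA.
  have H : pois_cdf j / pois j <= pois_cdf a / pois a.
    rewrite -(subnKC (ltnW ja)); elim: (a - j)%N => [|d IH]; first by rewrite addn0.
    by rewrite addnS (le_trans IH)// pois_cdf_ratio.
  apply: (@le_trans _ _ (pois a * (pois_cdf a / pois a))).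
    by rewrite ler_wpM2l ?(ltW (pois_gt0 _)).
  by rewrite mulrC divfK ?gt_eqF ?pois_gt0// pois_cdf_le1.
have c0 i : 0 <= 1 - pois_cdf i by rewrite subr_ge0 pois_cdf_le1.
rewrite (ger0_norm (mulr_ge0 (ltW (pois_gt0 a)) (c0 j))) -mulrA.
have H : (1 - pois_cdf j) / pois j <= (1 - pois_cdf a) / pois a.
  rewrite -(subnKC aj); elim: (j - a)%N => [|d IH]; first by rewrite addn0.
  by rewrite addnS (le_trans _ IH)// pois_tail_ratio.
apply: (@le_trans _ _ (pois a * ((1 - pois_cdf a) / pois a))).
  by rewrite ler_wpM2l ?(ltW (pois_gt0 _)).
by rewrite mulrC divfK ?gt_eqF ?pois_gt0// lerBlDr lerDl pois_cdf_ge0.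
Qed.

End poisson_stein.

(** * Stein's method for the translated Poisson law *)

Section local_bound.
Context {R : realType}.
Variable p : {i01 R}.
Notation q := (1 - p%:num : R).
Notation ew := (expect p).
Notation mu := (iso_mean p).
Notation dw := (bias_gap p).

(** By [expect_var], the variance for [n.+1] vertices, not for [n]. *)
Definition iso_var n : R := mu n.+1 * (1 - q ^+ n + p%:num * mu n).

Definition tp_pmf (mean v : R) (a : int) : R :=
  let s := Num.floor (mean - v) in
  if (a - s)%R is Posz k then pois (mean - s%:~R) k else 0.

(** Chebyshev's inequality: below the floor, W is at distance at least v from its mean, where v is
    the variance, and v / v^2 = 1 / v. *)
Lemma left_tail n : 0 < iso_var n ->
  ew n.+1 (fun w => (w%:Z < Num.floor (mu n.+1 - iso_var n))%R%:R) <= (iso_var n)^-1.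
Proof.
move=> v0.
have -> : (iso_var n)^-1 = (iso_var n ^+ 2)^-1 * ew n.+1 (fun w => (w%:R - mu n.+1) ^+ 2).
  by rewrite expect_var -/(iso_var n); field; rewrite gt_eqF.
rewrite -expectZ; apply: expect_le => w.
case: ltP => [ws|_]; last by rewrite mulr_ge0 ?sqr_ge0// invr_ge0 sqr_ge0.
rewrite mulrC ler_pdivlMr ?exprn_gt0// mul1r.
have : (w%:Z)%:~R < mu n.+1 - iso_var n.
  by apply: (lt_le_trans _ (floor_le _)); rewrite ltr_int.
rewrite -pmulrn => wv.
have -> : (w%:R - mu n.+1) ^+ 2 = (mu n.+1 - w%:R) ^+ 2 by ring.
by rewrite ler_pXn2r ?nnegrE//; lra.
Qed.

(** Below the support of the target only [left_tail] is needed. Elsewhere the constant 3 is 2 from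
    the rounding [m - v], which is in [0, 1), plus 1 from the left tail. *)
Lemma local_bound i (M B g : R) :
  setting p M B g -> (forall m, (i < m <= i + 6)%N -> regular p M B g m) ->
  forall a : int,
  `|ew i.+4.+1 (fun w => (w%:Z == a)%:R) - tp_pmf (mu i.+4.+1) (iso_var i.+4) a| <=
  (3 + 345 * B ^+ 3 / g ^+ 2) / iso_var i.+4.
Proof.
move=> HS reg a.
have [M1 B1 g0 g1 [p0 q0 q1 M0 pM]] := settingP HS.
have [L4 L5] : (i < i.+4 <= i + 6)%N /\ (i < i.+4.+1 <= i + 6)%N by clear; lia.
have [m4 m4B _ gap4] := reg _ L4.
have [m5 m5B _ _] := reg _ L5.
set n := i.+4 in m4 m4B gap4 m5 m5B *.
set v := iso_var n.
have Q0 : 0 < 1 - q ^+ n.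
  have : 0 <= p%:num * mu n / q ^+ 2 by rewrite divr_ge0 ?sqr_ge0// mulr_ge0 ?mu_ge0.
  by move: gap4; lra.
have v0 : 0 < v.
  apply: mulr_gt0; first exact: lt_le_trans m5.
  by rewrite ltr_pwDl// mulr_ge0 ?mu_ge0.
have := left_tail v0; rewrite -/v.
set s := Num.floor (mu n.+1 - v); set PL := ew n.+1 _ => PLv.
have PL0 : 0 <= PL.
  by rewrite -[leLHS](expect_cst p n.+1); apply: expect_le => w; case: (_ < _).
have K0 : 0 <= 345 * B ^+ 3 / g ^+ 2.
  apply: divr_ge0; last exact: sqr_ge0.
  by apply: mulr_ge0; [exact: ler0n | apply: exprn_ge0; lra].
have vi : 0 < v^-1 by rewrite invr_gt0.
rewrite /tp_pmf -/s.
have sm : s%:~R <= mu n.+1 - v by exact: floor_le.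
have ms : mu n.+1 - v < s%:~R + 1 by have := floorD1_gt (mu n.+1 - v); rewrite intrD.
clearbody s.
case E : (a - s)%R => [k|k]; last first.
  rewrite subr0 ger0_norm; last first.
    by rewrite -[leLHS](expect_cst p n.+1); apply: expect_le => w; case: (_ == _).
  apply: (@le_trans _ _ PL).
    apply: expect_le => w; case: eqP => [wa|_]; last by case: (_ < _).
    by have -> : (w%:Z < s) = true by clear -wa E; lia.
  by apply: (le_trans PLv); rewrite ler_peMl ?(ltW vi)//; lra.
set m := mu n.+1 - s%:~R.
have vm : v <= m by rewrite /m; lra.
have m0 : 0 < m by lra.
have mi : m^-1 <= v^-1 by rewrite lef_pV2 ?posrE.
(* The Stein solution moved to [s] and extended by 0; below [s] both sides of [GE] vanish. *)
pose G (w : nat) : R := if (w%:Z - s)%R is Posz j then stein_sol m k j else 0.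
have GE w : m * G w.+1 - (w%:R - s%:~R) * G w =
    (w%:Z == a)%:R - pois m k * (1 - (w%:Z < s)%R%:R).
  rewrite /G; case D : (w%:Z - s)%R => [j|j].
    have -> : (w.+1%:Z - s)%R = Posz j.+1 by clear -D; lia.
    have -> : (w%:Z < s)%R = false by clear -D; lia.
    have -> : w%:R - s%:~R = j%:R :> R.
      by rewrite -[j%:R]/((Posz j)%:~R) -D intrD intrN.
    have -> : (w%:Z == a) = (j == k) by clear -D E; lia.
    by rewrite stein_solP//= subr0 mulr1.
  have -> : (w%:Z < s)%R = true by clear -D; lia.
  have -> : (w%:Z == a) = false by clear -D E; lia.
  rewrite subrr mulr0 mulr0 !subr0.
  case D' : (w.+1%:Z - s)%R => [l|l]; last by rewrite mulr0.
  (* At w = s - 1 the value of [stein_sol] at 0 enters; it has to be 0. *)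
  have -> : l = 0%N by clear -D D'; lia.
  by rewrite /= mulr0.
have GB w : `|G w| <= m^-1.
  by rewrite /G; case: (w%:Z - s)%R => j; [exact: norm_stein_sol | rewrite normr0 invr_ge0 ltW].
have hB : unit_ball (fun w => m * G w).
  by move=> w; rewrite normrM (gtr0_norm m0) mulrC -ler_pdivlMr// mul1r.
pose P := ew n.+1 (fun w => (w%:Z == a)%:R).
(* The operator equals m DG(w) + (mu - w) G(w), since m = mu - s. The second part has mean mu times
   the gap of [G]; adding and subtracting v pairs it with its expansion. *)
have PE : P - pois m k * (1 - PL) =
    (m - v) * ew n.+1 (fdiff G) +
    mu n.+1 * (dw n G + (1 - q ^+ n + p%:num * mu n) * ew n.+1 (fdiff G)).
  have -> : P - pois m k * (1 - PL) =
      ew n.+1 (fun w => m * G w.+1 - (w%:R - s%:~R) * G w).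
    rewrite -[in LHS](expect1 p n.+1) -expectB -expectZ -expectB; congr (ew _ _).
    by apply/funext => w; rewrite GE.
  have -> : (fun w => m * G w.+1 - (w%:R - s%:~R) * G w) =
      (fun w => m * fdiff G w + 1 * ((mu n.+1 - w%:R) * G w)).
    by apply/funext => w; rewrite /fdiff /m; ring.
  rewrite expect_lin -bias_gap_size_bias /v /iso_var; ring.
have X1 : `|ew n.+1 (fdiff G)| <= 2 * m^-1 by apply: norm_expect; exact: norm_fdiff.
have X2 : `|(m - v) * ew n.+1 (fdiff G)| <= 2 * m^-1.
  rewrite normrM -[leRHS]mul1r; apply: ler_pM => //.
  by rewrite ger0_norm /m; lra.
(* The expansion applies to [m * G], which is in the unit ball; mu <= B M cancels 1/M and raises B^2
   to B^3. *)
have X3 : `|mu n.+1 * (dw n G + (1 - q ^+ n + p%:num * mu n) * ew n.+1 (fdiff G))|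
    <= 345 * B ^+ 3 / g ^+ 2 * m^-1.
  have := bias_gap_expansion HS reg hB; rewrite -/n.
  have -> : fdiff (fun w => m * G w) = (fun w => m * fdiff G w).
    by apply/funext => w; rewrite /fdiff; ring.
  rewrite bias_gapZ expectZ.
  have -> : m * dw n G + (1 - q ^+ n + p%:num * mu n) * (m * ew n.+1 (fdiff G)) =
    m * (dw n G + (1 - q ^+ n + p%:num * mu n) * ew n.+1 (fdiff G)) by ring.
  set Y := dw n G + _; rewrite [`|m * Y|]normrM [`|mu _ * Y|]normrM.
  rewrite (gtr0_norm m0) (ger0_norm (mu_ge0 p _)) => HY.
  rewrite ler_pdivlMr//; have -> : mu n.+1 * `|Y| * m = mu n.+1 * (m * `|Y|) by ring.
  apply: (@le_trans _ _ (B * M * (345 * B ^+ 2 / g ^+ 2 / M))).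
    exact: ler_pM (mu_ge0 p _) (mulr_ge0 (ltW m0) (normr_ge0 _)) m5B HY.
  by rewrite le_eqVlt; apply/orP; left; apply/eqP; field; rewrite !gt_eqF.
have pk : 0 <= pois m k <= 1.
  by rewrite (ltW (pois_gt0 m0 k)) (le_trans (pois_le_cdf m0 k))// pois_cdf_le1.
have X4 : `|pois m k * PL| <= v^-1.
  case/andP: pk => pk0 pk1.
  rewrite (ger0_norm (mulr_ge0 pk0 PL0)); apply: (le_trans _ PLv); exact: ler_piMl.
rewrite -/P.
have -> : P - pois m k = (m - v) * ew n.+1 (fdiff G) +
    mu n.+1 * (dw n G + (1 - q ^+ n + p%:num * mu n) * ew n.+1 (fdiff G)) -
    pois m k * PL.
  by rewrite -PE; ring.
apply: (le_trans (ler_normB _ _)); apply: (le_trans (lerD (ler_normD _ _) X4)).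
apply: (le_trans (lerD (lerD X2 X3) (lexx _))).
have X5 := ler_wpM2l K0 mi.
by rewrite mulrDl; clear -mi X5; lra.
Qed.

End local_bound.

(** * From measures and integrals to finite sums *)

Section translation.
Context {R : realType}.

Lemma esum_finType (T : finType) (a : T -> R) : (forall x, 0 <= a x) ->
  (\esum_(x in [set: T]) (a x)%:E)%E = (\sum_(x : T) a x)%:E.
Proof.
move=> a0; have fin : finite_set [set: T] by exact: finite_finset.
rewrite esum_fset//=; last by move=> x _; rewrite lee_fin.
rewrite fsbig_finite//= (perm_big (index_enum T))/= ?sumEFin//.
apply: uniq_perm => [||x]; [exact: finmap.fset_uniq|exact: index_enum_uniq|].
apply/idP/idP => _; first exact: mem_index_enum.
by rewrite in_fset_set//; exact: mem_set.
Qed.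

Lemma er_probE n (p : {i01 R}) (A : set (graph n)) :
  er_prob n p A = (\sum_(G : graph n) er_pmf p G * (G \in A)%:R)%:E.
Proof.
rewrite /er_prob esum_mkcond -esum_finType; last first.
  by move=> G; rewrite mulr_ge0// er_pmf_ge0.
by apply: eq_esum => G _; case: (G \in A); rewrite ?mulr1 ?mulr0.
Qed.

Lemma ge0_expectation_er_prob n (p : {i01 R}) (f : graph n -> R) :
  (forall G, 0 <= f G) ->
  ('E_(er_prob n p)[f])%E = (\sum_(G : graph n) er_pmf p G * f G)%:E.
Proof.
move=> f0; rewrite unlock.
have mA (A : set (graph n)) : measurable A by [].
have -> : [set: graph n] = \big[setU/set0]_(G <- index_enum (graph n)) [set G].
  apply/seteqP; split => // G _; rewrite -bigcup_seq; exists G => //=.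
  exact: mem_index_enum.
rewrite ge0_integral_bigsetU//=; last first.
- by move=> G _; rewrite lee_fin.
- by move=> G1 G2 _ _ [G [/= -> ->]].
- exact: index_enum_uniq.
rewrite -sumEFin; apply: eq_bigr => G _.
transitivity (\int[er_prob n p]_(x in [set G]) cst (f G)%:E x)%E.
  by apply: eq_integral => x; rewrite inE /= => ->.
transitivity ((f G)%:E * er_prob n p [set G])%E; first exact: integral_cst.
rewrite er_probE -EFinM mulrC; congr (_ * _)%:E.
rewrite (bigD1 G)//= big1 ?addr0; last first.
  by move=> H HG; rewrite memNset ?mulr0//= => E; rewrite E eqxx in HG.
by rewrite mem_set ?mulr1.
Qed.

Lemma isolated_lawE n (p : {i01 R}) (a : int) :
  isolated_law n p [set a] = (expect p n (fun w => (w%:Z == a)%:R))%:E.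
Proof.
rewrite /isolated_law /pushforward er_probE; congr (_%:E); apply: eq_bigr => G _.
by congr (_ * _%:R); congr nat_of_bool; apply/idP/eqP; rewrite inE.
Qed.

Lemma isolated_meanE n (p : {i01 R}) : isolated_mean n p = iso_mean p n.
Proof. by rewrite /isolated_mean ge0_expectation_er_prob// -expect_id. Qed.

Lemma isolated_varE n (p : {i01 R}) : isolated_var n.+1 p = iso_var p n.
Proof.
rewrite /isolated_var /variance covariance.unlock ge0_expectation_er_prob.
  rewrite -[fine 'E_(_)[_]]/(isolated_mean n.+1 p) isolated_meanE /= /iso_var -expect_var.
  by apply: eq_bigr => G _; rewrite -expr2.
by move=> G; rewrite /= -expr2 sqr_ge0.
Qed.

Lemma translated_poissonE (mean v : R) (a : int) : 0 < v ->
  translated_poisson mean v [set a] = (tp_pmf mean v a)%:E.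
Proof.
move=> v0; rewrite /translated_poisson /pushforward /poisson_prob /tp_pmf.
set s := Num.floor (mean - v).
have sm : s%:~R <= mean - v by exact: floor_le.
have -> : v + (mean - v - s%:~R) = mean - s%:~R by ring.
have m0 : 0 < mean - s%:~R by lra.
rewrite m0; case E : (a - s)%R => [k|k].
  have -> : (fun k : nat => (k%:Z + s)%R) @^-1` [set a] = [set k].
    by apply/seteqP; split => j /=; clear -E => ?; lia.
  rewrite esum_set1 ?lee_fin ?poisson_pmf_ge0//.
  by rewrite /poisson_pmf m0.
have -> : (fun k : nat => (k%:Z + s)%R) @^-1` [set a] = set0.
  by apply/seteqP; split => j //=; clear -E => ?; lia.
by rewrite esum_set0.
Qed.

Lemma dloc_isolated_le n (p : {i01 R}) (C : R) : 0 < iso_var p n ->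
  (forall a : int, `|expect p n.+1 (fun w => (w%:Z == a)%:R) -
     tp_pmf (iso_mean p n.+1) (iso_var p n) a| <= C) ->
  `|dloc (isolated_law n.+1 p)
      (translated_poisson (isolated_mean n.+1 p) (isolated_var n.+1 p))| <= C.
Proof.
move=> v0 H; rewrite /dloc; set E := [set _ | _ in _].
have HE : ubound E C.
  move=> _ [a _ <-]; rewrite isolated_lawE isolated_meanE isolated_varE.
  by rewrite translated_poissonE//=; exact: H.
have E0 : E !=set0 by eexists; exists 0.
rewrite ger0_norm; first exact: ge_sup.
have [x Ex] := E0; apply: (@le_trans _ _ x); first by case: Ex => a _ <-.
by apply: ub_le_sup => //; exists C.
Qed.

End translation.

(** * Constants in the sparse regime *)

Section constants.
Context {R : realType}.
Variable p : {i01 R}.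
Notation q := (1 - p%:num : R).
Notation mu := (iso_mean p).

(* The left-hand side is the probability that a binomial variable with
   parameters [m] and [p] is at least 2. *)
Lemma binomial_ge2 m :
  'C(m, 2)%:R * p%:num ^+ 2 * q ^+ m <= 1 - q ^+ m - p%:num * mu m.
Proof.
have q01 : 0 <= q <= 1 by rewrite subr_ge0 lerBlDr lerDl; apply/andP.
have qk k : 0 <= q ^+ k <= 1 by case/andP: q01 => ? ?; rewrite exprn_ge0 ?exprn_ile1.
rewrite /iso_mean; elim: m => [|m IH]; first by rewrite bin_small// !mul0r mulr0 expr0; lra.
case: m IH => [|m] IH; first by rewrite bin_small// !mul0r /= expr0 expr1; lra.
rewrite /= in IH *.
set c := 'C(m.+1, 2)%:R * p%:num ^+ 2 in IH *.
have c0 : 0 <= c by rewrite mulr_ge0// sqr_ge0.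
have [H0 H1] := andP (qk m.+1).
have E1 : c * q ^+ m.+2 <= c * q ^+ m.+1.
  by rewrite ler_wpM2l// [leLHS]exprS ler_piMl//; case/andP: q01.
set d := m.+1%:R * p%:num ^+ 2.
have d0 : 0 <= d by rewrite mulr_ge0// sqr_ge0.
have E2 : d * q ^+ m.+2 <= d * q ^+ m.
  by rewrite ler_wpM2l// -addn2 exprD ler_piMr//; case/andP: (qk 2%N).
(* The increment is the probability that the last trial is the second success. *)
have -> : 1 - q ^+ m.+2 - p%:num * (m.+2%:R * q ^+ m.+1) =
    (1 - q ^+ m.+1 - p%:num * (m.+1%:R * q ^+ m)) + d * q ^+ m.
  by rewrite /d !exprS -[m.+2]addn1 -[m.+1]addn1 !natrD; ring.
have -> : 'C(m.+2, 2)%:R = 'C(m.+1, 2)%:R + m.+1%:R :> R by rewrite (binS m.+1) bin1 natrD.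
rewrite !mulrDl -/c -/d; lra.
Qed.

Lemma expR_le_q : p%:num <= 2^-1 -> expR (- 2 * p%:num) <= q.
Proof.
move=> p2; have p0 : 0 <= p%:num by [].
have H := expR_ge1Dx (2 * p%:num); rewrite mulNr expRN.
apply: (@le_trans _ _ (1 + 2 * p%:num)^-1).
  by rewrite lef_pV2 ?posrE ?expR_gt0//; lra.
rewrite -[leLHS]mul1r ler_pdivrMr; last by lra.
nra.
Qed.

(** [expR_le_q] gives q^m >= k, so mu_m is between n k / 2 and 2 n; hence 4 / k in [B], while 1 + 6
    l bounds increments of the mean. By [binomial_ge2] the gap with p mu is at least l^2 k / 64;
    half of it is spent on the division by q^2. *)
Lemma regular_of_mean_degree (l : R) n m :
  0 < l -> (10 <= n)%N -> (n <= m + 4)%N -> (m <= n + 1)%N ->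
  l / 2 <= n%:R * p%:num -> n%:R * p%:num <= 3 / 2 * l -> p%:num <= 2^-1 ->
  let k := expR (- 6 * l) in
  p%:num <= l * k / 3072 ->
  regular p (n%:R * k / 2) (4 / k + 1 + 6 * l) (Num.min 1 (l ^+ 2 * k / 128)) m.
Proof.
move=> l0 n10 nm mn pl pu p2 k pk.
have k0 : 0 < k := expR_gt0 _.
have p0 : 0 <= p%:num by [].
have p1 : p%:num <= 1 by [].
have q0 : 0 < q by lra.
have q12 : 2^-1 <= q by lra.
have q1 : q <= 1 by lra.
have qk j : 0 <= q ^+ j <= 1 by rewrite exprn_ge0 ?exprn_ile1//; lra.
have n0 : 0 < n%:R :> R by rewrite ltr0n; clear -n10; lia.
have m_ge : n%:R / 2 <= m%:R :> R.
  by rewrite ler_pdivrMr// -natrM ler_nat; clear -n10 nm; lia.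
have m_le : m%:R <= 2 * n%:R :> R by rewrite -natrM ler_nat; clear -n10 mn; lia.
have mp_ge : l / 4 <= m%:R * p%:num.
  by have := ler_wpM2r p0 m_ge; lra.
have mp_le : m%:R * p%:num <= 3 * l.
  by have := ler_wpM2r p0 m_le; lra.
have qm : k <= q ^+ m.
  apply: (@le_trans _ _ (expR (- 2 * p%:num) ^+ m)); last first.
    by rewrite ler_pXn2r ?nnegrE ?expR_ge0 ?(ltW q0)// ?expR_le_q//; clear -n10 nm; lia.
  by rewrite -expRM_natl ler_expR -mulr_natl; lra.
have mS : m = m.-1.+1 by clear -n10 nm; lia.
have qm1 : k <= q ^+ m.-1.
  by apply: (le_trans qm); rewrite {1}mS exprS ler_piMl// exprn_ge0// ltW.
have muE : mu m = m%:R * q ^+ m.-1 by [].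
have [qm10 qm11] := andP (qk m.-1).
split.
- rewrite muE.
  have : n%:R / 2 * k <= m%:R * q ^+ m.-1 by apply: ler_pM => //; rewrite ?divr_ge0// ltW.
  lra.
- have : mu m <= 2 * n%:R.
    by rewrite muE; apply: le_trans m_le; rewrite ler_piMr.
  have -> : (4 / k + 1 + 6 * l) * (n%:R * k / 2) = 2 * n%:R + (1 + 6 * l) * (n%:R * k / 2).
    by field; rewrite gt_eqF.
  have : 0 <= (1 + 6 * l) * (n%:R * k / 2).
    by rewrite mulr_ge0// ?divr_ge0// ?mulr_ge0// ?ltW//; lra.
  lra.
- have k4 : 0 < 4 / k by rewrite divr_gt0.
  have -> : mu m.+1 - mu m = q ^+ m.-1 * (1 - m.+1%:R * p%:num).
    by have := muS_sub p m.-1; rewrite -mS.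
  have m1p : m.+1%:R * p%:num <= 6 * l.
    have : m.+1%:R <= 2 * m%:R :> R by rewrite -natrM ler_nat; clear -n10 nm; lia.
    by move=> /(ler_wpM2r p0); lra.
  have m1p0 : 0 <= m.+1%:R * p%:num by rewrite mulr_ge0.
  rewrite normrM ger0_norm// -[leRHS]mul1r ler_pM// ler_norml; lra.
- have H := binomial_ge2 m.
  have C2 : m%:R ^+ 2 <= 4 * 'C(m, 2)%:R :> R.
    rewrite -natrX -natrM ler_nat; have := mul_bin_diag m 1; rewrite bin1; clear -n10 nm; nia.
  have H2 : l ^+ 2 * k / 64 <= 'C(m, 2)%:R * p%:num ^+ 2 * q ^+ m.
    apply: (@le_trans _ _ ((m%:R * p%:num) ^+ 2 / 4 * k)).
      have : (l / 4) ^+ 2 <= (m%:R * p%:num) ^+ 2 by rewrite ler_pXn2r ?nnegrE//; lra.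
      move=> /(ler_wpM2r (ltW k0)); lra.
    apply: ler_pM; [by rewrite divr_ge0// sqr_ge0 | exact: ltW | | exact: qm].
    have := ler_wpM2r (sqr_ge0 p%:num) C2; rewrite exprMn; lra.
  (* From p mu <= 3 l, 1 - q^2 <= 2 p and q^2 >= 1/4, as 3 * 2 * 4 = 24; then 24 * 128 = 3072
     explains the bound on p. *)
  have H3 : p%:num * mu m / q ^+ 2 <= p%:num * mu m + 24 * l * p%:num.
    have pmu : p%:num * mu m <= 3 * l.
      by rewrite muE mulrA [p%:num * _]mulrC; apply: le_trans mp_le; rewrite ler_piMr// mulr_ge0.
    have pmu0 : 0 <= p%:num * mu m by rewrite mulr_ge0// mu_ge0.
    rewrite ler_pdivrMr ?exprn_gt0//.
    have E : q ^+ 2 = 1 - p%:num * (2 - p%:num) by ring.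
    have q4 : 4^-1 <= q ^+ 2 by nra.
    have : p%:num * mu m * (p%:num * (2 - p%:num)) <= 3 * l * (p%:num * 2).
      apply: ler_pM; [exact: pmu0 | | exact: pmu | by rewrite ler_wpM2l//; lra].
      by rewrite mulr_ge0//; lra.
    have : 24 * l * p%:num * 4^-1 <= 24 * l * p%:num * q ^+ 2.
      by rewrite ler_wpM2l// !mulr_ge0// ltW.
    rewrite mulrDl {1}E; lra.
  have H4 : 24 * l * p%:num <= l ^+ 2 * k / 128.
    have := ler_wpM2l (ltW l0) pk; rewrite expr2; lra.
  apply: (@le_trans _ _ (l ^+ 2 * k / 128)); first by rewrite ge_min lexx orbT.
  lra.
Qed.

Lemma iso_var_ge (M B g : R) n : 0 <= M -> 0 <= g -> 0 < q ->
  regular p M B g n -> regular p M B g n.+1 -> M * g <= iso_var p n.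
Proof.
move=> M0 g0 q0 [_ _ _ gap] [Mmu _ _ _]; rewrite /iso_var; apply: ler_pM => //.
have pmu : 0 <= p%:num * mu n by rewrite mulr_ge0// mu_ge0.
have := divr_ge0 pmu (sqr_ge0 q); lra.
Qed.

End constants.

(** * Explicit bound for large n and the asymptotic statement *)

Lemma dloc_isolated_bound {R : realType} (lambda : R) : 0 < lambda ->
  exists C A : R, forall (n : nat) (p : {i01 R}), (10 <= n)%N -> A <= n%:R ->
    lambda / 2 <= n%:R * p%:num -> n%:R * p%:num <= 3 / 2 * lambda ->
    expR 2 <= isolated_var n p /\
    `|dloc (isolated_law n p)
       (translated_poisson (isolated_mean n p) (isolated_var n p))|
    <= C / isolated_var n p.
Proof.
move=> l0.
pose k : R := expR (- 6 * lambda).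
pose B : R := 4 / k + 1 + 6 * lambda.
pose g : R := Num.min 1 (lambda ^+ 2 * k / 128).
have k0 : 0 < k := expR_gt0 _.
have g0 : 0 < g by rewrite lt_min ltr01 divr_gt0// mulr_gt0// exprn_gt0.
(* The three terms of the threshold ensure p <= 1/2, then p <= lambda k / 3072 (with 3072 * 3/2 =
   4608) and M >= 1, then a variance of at least e^2. *)
exists (3 + 345 * B ^+ 3 / g ^+ 2), (3 * lambda + 4608 / k + 2 * expR 2 / (k * g)).
move=> n p n10 nA pl pu.
have n0 : 0 < n%:R :> R by rewrite ltr0n; clear -n10; lia.
have k1 : k <= 1 by rewrite /k -[leRHS]expR0 ler_expR; lra.
have g1 : g <= 1 by rewrite ge_min lexx.
have k4 : 0 < 4 / k by rewrite divr_gt0.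
have A2 : 0 < 4608 / k by apply: (divr_gt0 _ k0); rewrite ltr0n.
have A3 : 0 < 2 * expR 2 / (k * g).
  apply: divr_gt0; first by apply: mulr_gt0; [rewrite ltr0n | exact: expR_gt0].
  exact: mulr_gt0.
have nk : 4608 <= n%:R * k.
  by rewrite -ler_pdivrMr//; clear -nA A2 A3 l0; lra.
have nkg : expR 2 <= n%:R * k / 2 * g.
  have : 2 * expR 2 <= n%:R * (k * g).
    by rewrite -ler_pdivrMr ?mulr_gt0//; clear -nA A2 A3 l0; lra.
  clear; lra.
have p0 : 0 < p%:num :> R by rewrite -(pmulr_rgt0 _ n0); clear -pl l0; lra.
have pk : p%:num <= lambda * k / 3072.
  rewrite -(ler_pM2l n0); have := ler_wpM2l (ltW l0) nk; clear -pu; lra.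
have p2 : p%:num <= 2^-1 :> R.
  by rewrite -(ler_pM2l n0); clear -pu nA A2 A3; lra.
have M1 : 1 <= n%:R * k / 2 by clear -nk; lra.
have B1 : 1 <= B by rewrite /B; clear -k4 l0; lra.
have HS : setting p (n%:R * k / 2) B g.
  split; split => //; [by rewrite g0 g1 | by clear -p2; lra |].
  have : n%:R * p%:num * k <= 3 / 2 * lambda * 1.
    by apply: ler_pM; [apply: mulr_ge0; apply: ltW | exact: ltW | exact: pu | exact: k1].
  by rewrite /B; clear -k4 l0; lra.
(* With n = i + 5, the indices from i + 1 to i + 6 run from n - 4 to n + 1. *)
have [i ni] : exists i, n = i.+4.+1 by exists (n - 5)%N; clear -n10; lia.
have reg m : (i < m <= i + 6)%N -> regular p (n%:R * k / 2) B g m.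
  move=> im; apply: (@regular_of_mean_degree _ p lambda n m) => //; clear -n10 ni im; lia.
have v_ge : n%:R * k / 2 * g <= iso_var p i.+4.
  apply: (@iso_var_ge _ _ _ B) => //; last 2 first.
  - by apply: reg; clear; lia.
  - by apply: reg; clear; lia.
  - exact: le_trans M1.
  - exact: ltW.
  - by clear -p2; lra.
have LB := local_bound HS reg.
have v0 : 0 < iso_var p i.+4 by apply: lt_le_trans v_ge; apply: lt_le_trans nkg; exact: expR_gt0.
have DL := dloc_isolated_le v0 LB.
rewrite -ni in DL.
have VE : isolated_var n p = iso_var p i.+4 by rewrite -isolated_varE -ni.
rewrite VE in DL *; split; [exact: le_trans nkg v_ge | exact: DL].
Qed.

Theorem theorem2p11 (R : realType) (lambda : R) (p : nat -> {i01 R}) :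
  0 < lambda ->
  (fun n : nat => (p n)%:num : R^o) ~_\oo (fun n : nat => lambda / n%:R : R^o) ->
  let sigma (n : nat) : R := Num.sqrt (isolated_var n (p n)) in
  (fun n : nat =>
     dloc (isolated_law n (p n))
       (translated_poisson (isolated_mean n (p n)) (isolated_var n (p n)))
     : R^o)
  =O_\oo (fun n : nat => Num.sqrt (ln (sigma n)) / sigma n ^+ 2 : R^o).
Proof.
move=> l0 /eqaddoP plim sigma.
have [C [A HCA]] := dloc_isolated_bound l0.
apply/eqOP; near=> K; near=> n.
have CK : C <= K by near: K; apply: nbhs_pinfty_ge; exact: num_real.
have K0 : 0 <= K by near: K; apply: nbhs_pinfty_ge; exact: num_real.
have n10 : (10 <= n)%N by near: n; exact: nbhs_infty_ge.
have nA : A <= n%:R by near: n; exact: nbhs_infty_ger.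
have pn : `|(p n)%:num - lambda / n%:R| <= 2^-1 * `|lambda / n%:R| :> R.
  by near: n; apply: plim; rewrite invr_gt0.
have n0 : 0 < n%:R :> R by rewrite ltr0n; clear -n10; lia.
have [pl pu] : lambda / 2 <= n%:R * (p n)%:num /\ n%:R * (p n)%:num <= 3 / 2 * lambda.
  move: pn; rewrite (gtr0_norm (divr_gt0 l0 n0)) ler_norml => /andP[pn1 pn2].
  have ln : n%:R * (lambda / n%:R) = lambda by rewrite mulrC divfK ?gt_eqF.
  have := ler_wpM2l (ltW n0) pn1; have := ler_wpM2l (ltW n0) pn2.
  rewrite mulrBr mulrN !(mulrCA _ 2^-1) ln; clear -l0; lra.
have [v_ge DL] := HCA n (p n) n10 nA pl pu.
have v0 : 0 < isolated_var n (p n) by apply: lt_le_trans v_ge; exact: expR_gt0.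
have sE : sigma n ^+ 2 = isolated_var n (p n) by rewrite sqr_sqrtr ?(ltW v0).
have s_gt0 : 0 < sigma n by rewrite sqrtr_gt0.
(* A variance of at least e^2 makes the logarithmic factor at least 1, so the sharper bound C /
   sigma^2 implies the stated one. *)
have lns : 1 <= ln (sigma n).
  rewrite -[leLHS](expRK 1) ler_ln ?posrE ?expR_gt0//.
  by rewrite -(@ler_pXn2r _ 2) ?nnegrE ?expR_ge0 ?(ltW s_gt0)// sE -expRM_natl mulr_natl.
apply: (le_trans DL).
rewrite sE normrM normfV (gtr0_norm v0) ger0_norm ?sqrtr_ge0// mulrA.
rewrite ler_pM2r ?invr_gt0//; apply: (le_trans CK).
by rewrite ler_peMr// -[leLHS]sqrtr1 ler_sqrt// (le_trans ler01).
Unshelve. all: end_near.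
Qed.
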